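(* Let $t\in\mathbb{N}$, $p\in\mathbb{N}\cup\{0\}$ and $a,b\in\mathbb{R}$ with $ab>0$. Put $q=\frac{a}{b}$ and $$\mathbf{I}^{-}(a,b,p,t):=\int_{-\infty}^{\infty}\frac{x^{p}\,\mathrm{Li}_{t}(-e^{ax})}{1+e^{bx}}\,\mathrm{d}x .$$ Then the following identities hold. If $p+t$ is odd, $$\frac{\operatorname{sign}(b)}{p!}\,b^{p+1}\,\mathbf{I}^{-}(a,b,p,t)=\frac{(-1)^{p+1}}{q^{p+1}}\,\eta(p+t+1)-2\sum_{j=0}^{\lfloor t/2\rfloor}q^{t-2j}\binom{p+t-2j}{p}\,\eta(p+t+1-2j)\,\eta(2j).$$ If $p+t$ is even, $$\frac{\operatorname{sign}(b)}{p!}\,b^{p+1}\,\mathbf{I}^{-}(a,b,p,t)=\frac{(-1)^{p+1}}{q^{p+1}}\,\eta(p+t+1)-2\sum_{j=0}^{\lfloor t/2\rfloor}q^{t-2j}\binom{p+t-2j}{p}\,\eta(p+t+1-2j)\,\eta(2j)$$ $$\qquad\qquad+2(-1)^{p+1}\Bigl[\mathbb{S}^{+-}_{p+1,t}(q)-2^{-p}\,\mathbb{S}^{+-}_{p+1,t}\bigl(\tfrac{q}{2}\bigr)-\eta(p+1)\,\eta(t)\Bigr].$$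
   Context: $\mathbb{N}=\{1,2,3,\dots\}$. $\mathrm{Li}_t$ is the polylogarithm, $\mathrm{Li}_t(z)=\sum_{k\ge1}z^k/k^t$ for $|z|<1$, extended by analytic continuation; for $y\ge 0$, $\mathrm{Li}_t(-y)$ is the (real) value of the analytic continuation along the negative real axis. In particular $\mathrm{Li}_1(-y)=-\log(1+y)$. $\eta$ is the Dirichlet eta function, $\eta(s)=\sum_{n\ge1}(-1)^{n+1}n^{-s}$ for $\Re(s)>0$, with $\eta(1)=\log 2$, extended analytically by $\eta(s)=(1-2^{1-s})\zeta(s)$ for $s\ne1$, where $\zeta$ is the Riemann zeta function; in particular $\eta(0)=\tfrac12$. For real $\lambda>0$ and $m\in\mathbb{N}$ the extended harmonic numbers are $H^{(1)}_\lambda=\gamma+\psi(\lambda+1)$ and, for $m\ge2$, $H^{(m)}_\lambda=\zeta(m)+\frac{(-1)^{m-1}}{(m-1)!}\psi^{(m-1)}(\lambda+1)$. Here $\gamma$ is the Euler–Mascheroni constant, $\psi=\Gamma'/\Gamma$ is the digamma function, and $\psi^{(k)}$ is its $k$-th derivative, $\psi^{(k)}(z)=(-1)^{k+1}k!\sum_{r\ge0}(r+z)^{-k-1}$ for $k\ge 1$. For $\lambda\in\mathbb{N}$ this gives $H^{(m)}_\lambda=\sum_{j=1}^{\lambda}j^{-m}$. For real $r>0$ and $m,t\in\mathbb{N}$, the linear harmonic Euler sums are $\mathbb{S}^{+-}_{m,t}(r)=\sum_{n=1}^{\infty}(-1)^{n+1}\frac{H^{(m)}_{rn}}{n^{t}}$.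 *)

(* Defs.v *)
From Stdlib Require Import Reals Factorial ClassicalEpsilon.
From Coquelicot Require Import Coquelicot.
Open Scope R_scope.

(** Real-analyticity at [x0]: [f] is the sum of a power series centred at
    [x0] on some neighbourhood of [x0]. *)
Definition analytic_at (f : R -> R) (x0 : R) : Prop :=
  exists a : nat -> R, locally x0 (fun x => is_pseries a (x - x0) (f x)).

(** [L] is the polylogarithm of order [t] on the real half-line [x < 1]: the
    analytic continuation, along the negative real axis, of the series
    [sum_(k >= 1) x^k / k^t] ([|x| < 1]).  As the half-line is connected, these
    conditions determine [L] there; nothing is required for [x >= 1]. *)
Definition is_polylog (t : nat) (L : R -> R) : Prop :=
  (forall x : R, Rabs x < 1 ->
     is_series (fun k : nat => x ^ S k / INR (S k) ^ t) (L x)) /\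
  (forall x : R, x < 1 -> analytic_at L x).

Definition polylog (t : nat) : R -> R :=
  epsilon (inhabits (fun _ : R => 0)) (is_polylog t).

(** Dirichlet eta function at the nonnegative integers.  The series diverges at
    [0], where the continuation [(1 - 2^(1-s)) zeta(s)] takes the value
    [(1 - 2) * (- 1/2) = 1/2]. *)
Definition eta (s : nat) : R :=
  match s with
  | O => 1 / 2
  | S _ => Series (fun k : nat => (-1) ^ (S k + 1) / INR (S k) ^ s)
  end.

(** Riemann zeta function at the integers [s >= 2]. *)
Definition zeta (s : nat) : R := Series (fun k : nat => / INR (S k) ^ s).

Definition euler_gamma : R :=
  real (Lim_seq (fun n : nat => sum_f_R0 (fun k => / INR (S k)) n - ln (INR (S n)))).

(** For [s > 0]. *)
Definition Gamma (s : R) : R :=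
  RInt_gen (fun u : R => Rpower u (s - 1) * exp (- u))
    (at_right 0) (Rbar_locally p_infty).

Definition digamma (x : R) : R := Derive Gamma x / Gamma x.

Definition polygamma (k : nat) (x : R) : R := Derive_n digamma k x.

(** Extended harmonic number [H^(m)_lam], for [m >= 1] and [lam > 0]. *)
Definition harmonic (m : nat) (lam : R) : R :=
  if Nat.eqb m 1 then euler_gamma + digamma (lam + 1)
  else zeta m
       + (-1) ^ (m - 1) / INR (fact (m - 1)) * polygamma (m - 1) (lam + 1).

(** Linear harmonic Euler sum [S^{+-}_{m,t}(r)]; the summation index is
    [n = S k]. *)
Definition euler_sum_pm (m t : nat) (r : R) : R :=
  Series (fun k : nat =>
    (-1) ^ (S k + 1) * (harmonic m (r * INR (S k)) / INR (S k) ^ t)).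

Definition integrand (a b : R) (p t : nat) (x : R) : R :=
  x ^ p * polylog t (- exp (a * x)) / (1 + exp (b * x)).

Definition I_minus (a b : R) (p t : nat) : R :=
  RInt_gen (integrand a b p t) (Rbar_locally m_infty) (Rbar_locally p_infty).

(** The part of the right-hand side common to both parities.  Coquelicot
    rebinds [C] to the complex numbers, hence the qualified binomial. *)
Definition eta_part (p t : nat) (q : R) : R :=
  (-1) ^ (p + 1) / q ^ (p + 1) * eta (p + t + 1)
  - 2 * sum_f_R0 (fun j : nat =>
          q ^ (t - 2 * j) * Binomial.C (p + t - 2 * j) p
          * eta (p + t + 1 - 2 * j) * eta (2 * j)) (t / 2).

(* Main.v *)
(** Put [F_t y = Li_t (- exp y)], so that [F_(t+1)' = F_t].  After rescaling by [b] one is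
    left with the integral of [u^p F_t (q u) / (1 + e^u)] over the line.  On the positive
    half-line the inversion formula [F_t y + (-1)^t F_t (- y) = -2 sum_j eta(2j) y^(t-2j) / (t-2j)!]
    produces the sum of products of eta values and [-(-1)^t J], where
    [J] is the integral of [u^p F_t (- q u) / (1 + e^u)] over the positive half-line.  On the
    negative half-line, [1 / (1 + e^(-u)) = 1 - 1 / (1 + e^u)] produces the term in
    [eta (p+t+1)] and [-(-1)^p J].  So [J] cancels when [p + t] is odd.  Expanding
    [F_t] and the Fermi factor into alternating exponential series turns [J] into
    the double series of [(-1)^(n+j) / (n^t (j + q n)^(p+1))], whose inner sum is
    [H_(qn) - 2^(-p) H_(qn/2) - eta (p+1)] up to sign, because the extended harmonic number is
    [H_lam = sum_j (1/j^(p+1) - 1/(j+lam)^(p+1))]. *)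

Require Import Defs.
From Stdlib Require Import Reals Factorial ClassicalEpsilon Lra Lia.
From Coquelicot Require Import Coquelicot.
Open Scope R_scope.

(** * Real-analytic functions and the polylogarithm *)

(** Three objects resist direct use. [polylog] is chosen by [epsilon], so nothing is known of it
    until some function satisfies [is_polylog]; one is built by repeated integration from
    [x / (1 - x)], and the identity theorem on [x < 1] transfers its derivative to [polylog].
    [digamma] is a quotient by [Gamma] of [Derive Gamma], with [Gamma] an improper integral; instead
    of differentiating under the integral sign, the increments of [ln (Gamma s)] are squeezed by
    Jensen's inequality and the functional equation, in the manner of Bohr and Mollerup. Only
    arguments above 1 are met, because [harmonic] evaluates at [lam + 1], and there the integrand of
    [Gamma] extends continuously to 0. Lastly, the double series may fail to converge absolutely (it
    does for [p = 0], [t = 1]), so absolute summability cannot justify exchanging sum and integral.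
    Instead, each expansion alternates: its remainder is at most the first omitted term, whose
    integral has the shape [s! / (c + d N)^(s+1)] and tends to 0. *)

Lemma locally_Rabs (x0 : R) (P : R -> Prop) :
  locally x0 P <-> exists r : R, 0 < r /\ forall x, Rabs (x - x0) < r -> P x.
Proof.
  split.
  - intros [e He]. exists e. split. apply cond_pos. intros x Hx. now apply He.
  - intros [r [Hr H]]. exists (mkposreal r Hr). intros x Hx. now apply H.
Qed.

Lemma locally_lt (x0 c : R) : x0 < c -> locally x0 (fun x => x < c).
Proof. intros H. now apply (locally_open (fun x => x < c)); [apply open_lt | |]. Qed.

Lemma locally_gt (x0 c : R) : c < x0 -> locally x0 (fun x => c < x).
Proof. intros H. now apply (locally_open (fun x => c < x)); [apply open_gt | |]. Qed.

Lemma INR_S_pos (n : nat) : 0 < INR (S n).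
Proof. apply lt_0_INR. lia. Qed.

Lemma INR_S_pow_pos (n t : nat) : 0 < INR (S n) ^ t.
Proof. apply pow_lt, INR_S_pos. Qed.

Lemma INR_S_pow_neq_0 (n t : nat) : INR (S n) ^ t <> 0.
Proof. apply Rgt_not_eq, INR_S_pow_pos. Qed.

Definition has_expansion (f : R -> R) (x0 : R) (a : nat -> R) (r : R) : Prop :=
  forall x, Rabs (x - x0) < r ->
    Rbar_lt (Rabs (x - x0)) (CV_radius a) /\ f x = PSeries a (x - x0).

(** Convergence at the single point [x0 + r / 2] puts the radius of convergence at or above [r / 2],
    so closer points lie strictly inside the disk. Halving [r] thus buys what Cauchy products and
    termwise differentiation require. *)
Lemma analytic_at_expansion (f : R -> R) (x0 : R) :
  analytic_at f x0 <-> exists a r, 0 < r /\ has_expansion f x0 a r.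
Proof.
  split.
  - intros [a Ha]. apply locally_Rabs in Ha. destruct Ha as [r [Hr Ha]].
    exists a, (r / 2). split. lra. intros x Hx.
    assert (Hy : is_pseries a (r / 2) (f (x0 + r / 2))).
    { replace (is_pseries a (r / 2)) with (is_pseries a (x0 + r / 2 - x0))
        by (f_equal; ring).
      apply Ha. replace (x0 + r / 2 - x0) with (r / 2) by ring.
      rewrite Rabs_pos_eq; lra. }
    split.
    + apply Rbar_lt_le_trans with (Rabs (r / 2)).
      * simpl. rewrite (Rabs_pos_eq (r / 2)); lra.
      * apply Rbar_not_lt_le. intros Hlt.
        apply (CV_disk_outside _ _ Hlt). apply ex_series_lim_0.
        exists (f (x0 + r / 2)). now apply is_pseries_R.
    + symmetry. apply is_pseries_unique, Ha. lra.
  - intros [a [r [Hr H]]]. exists a. apply locally_Rabs. exists r. split. easy.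
    intros x Hx. destruct (H x Hx) as [H1 H2]. rewrite H2.
    now apply PSeries_correct, CV_radius_inside.
Qed.

Lemma analytic_ext_loc (f g : R -> R) (x0 : R) :
  locally x0 (fun x => f x = g x) -> analytic_at f x0 -> analytic_at g x0.
Proof.
  intros E [a Ha]. exists a. generalize (filter_and _ _ E Ha).
  apply filter_imp. intros x [Ex Hx]. now rewrite <- Ex.
Qed.

Lemma analytic_const (c x0 : R) : analytic_at (fun _ => c) x0.
Proof.
  apply analytic_at_expansion. exists (fun n => match n with O => c | S _ => 0 end), 1.
  assert (E : CV_radius (fun n => match n with O => c | S _ => 0 end) = p_infty).
  { rewrite <- CV_radius_decr_1. rewrite (CV_radius_ext _ (fun _ => 0)) by easy.
    apply CV_radius_const_0. }
  split. lra. intros x Hx. rewrite E. split. easy.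
  rewrite PSeries_decr_1 by (apply CV_radius_inside; now rewrite E).
  rewrite (PSeries_ext _ (fun _ => 0)) by easy. rewrite PSeries_const_0. ring.
Qed.

Lemma analytic_scal (c : R) (f : R -> R) (x0 : R) :
  analytic_at f x0 -> analytic_at (fun x => c * f x) x0.
Proof.
  intros [a Ha]. exists (PS_scal c a). revert Ha. apply filter_imp. intros x Hx.
  apply (is_pseries_scal c a (x - x0) (f x)). apply Rmult_comm. easy.
Qed.

Lemma analytic_plus (f g : R -> R) (x0 : R) :
  analytic_at f x0 -> analytic_at g x0 -> analytic_at (fun x => f x + g x) x0.
Proof.
  intros [a Ha] [b Hb]. exists (PS_plus a b). generalize (filter_and _ _ Ha Hb).
  apply filter_imp. intros x [Hx Hy].
  exact (is_pseries_plus a b (x - x0) _ _ Hx Hy).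
Qed.

Lemma analytic_mult (f g : R -> R) (x0 : R) :
  analytic_at f x0 -> analytic_at g x0 -> analytic_at (fun x => f x * g x) x0.
Proof.
  intros Hf Hg. apply analytic_at_expansion in Hf, Hg.
  destruct Hf as [a [r [Hr Ha]]]. destruct Hg as [b [s [Hs Hb]]].
  exists (PS_mult a b). apply locally_Rabs. exists (Rmin r s).
  split. now apply Rmin_pos. intros x Hx.
  destruct (Ha x) as [H1 H2]. { eapply Rlt_le_trans; [apply Hx | apply Rmin_l]. }
  destruct (Hb x) as [H3 H4]. { eapply Rlt_le_trans; [apply Hx | apply Rmin_r]. }
  rewrite H2, H4.
  apply is_pseries_mult; try easy; now apply PSeries_correct, CV_radius_inside.
Qed.

(** Geometric series in [- (x - x0) / d] with [d = x0 - c], which converges up to the pole. *)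
Lemma analytic_inv_sub (c x0 : R) : x0 <> c -> analytic_at (fun x => / (x - c)) x0.
Proof.
  intros Hc. set (d := x0 - c). assert (Hd : d <> 0) by (unfold d; lra).
  exists (fun n => / d * (- / d) ^ n). apply locally_Rabs.
  exists (Rabs d). split. now apply Rabs_pos_lt. intros x Hx.
  apply is_pseries_R.
  assert (Hq : Rabs (- (x - x0) / d) < 1).
  { unfold Rdiv. rewrite Rabs_mult, Rabs_Ropp, Rabs_inv.
    apply Rmult_lt_reg_r with (Rabs d). now apply Rabs_pos_lt.
    rewrite Rmult_assoc, Rinv_l, Rmult_1_r, Rmult_1_l. easy. now apply Rabs_no_R0. }
  assert (Hne : x - c <> 0).
  { intros E. assert (x - x0 = - d) by (unfold d; lra).
    rewrite H, Rabs_Ropp in Hx. lra. }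
  assert (E : / (x - c) = / d * / (1 - - (x - x0) / d)).
  { replace (x - c) with (d * (1 - - (x - x0) / d)) by (unfold d in *; field; easy).
    apply Rinv_mult. }
  rewrite E.
  apply is_series_ext with (fun n => scal (/ d) ((- (x - x0) / d) ^ n)).
  - intros n. unfold scal; simpl; unfold mult; simpl.
    rewrite Rmult_assoc, <- Rpow_mult_distr. f_equal. f_equal. field. easy.
  - apply (is_series_scal (/ d) _ (/ (1 - - (x - x0) / d))).
    now apply is_series_geom.
Qed.

Lemma constant_of_derive_0 (f : R -> R) (x0 r : R) :
  (forall x, Rabs (x - x0) < r -> is_derive f x 0) ->
  forall x, Rabs (x - x0) < r -> f x = f x0.
Proof.
  intros H x Hx. destruct (Rtotal_order x x0) as [L | [-> | L]].
  - apply eq_is_derive; [| easy]. intros t Ht. apply H.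
    rewrite Rabs_left1 in Hx by lra. rewrite Rabs_left1; lra.
  - easy.
  - symmetry. apply eq_is_derive; [| easy]. intros t Ht. apply H.
    rewrite Rabs_pos_eq in Hx by lra. rewrite Rabs_pos_eq; lra.
Qed.

(** The difference of [F] and the series has derivative 0 on the interval and vanishes at the
    centre. Keeping the radius [r] matters: it yields the polylogarithm series on the whole of
    [(-1, 1)]. *)
Lemma expansion_antiderivative (F f : R -> R) (x0 r : R) (a : nat -> R) :
  has_expansion f x0 (PS_derive a) r -> a 0%nat = F x0 ->
  (forall x, Rabs (x - x0) < r -> is_derive F x (f x)) ->
  has_expansion F x0 a r.
Proof.
  intros Hf H0 HF x Hx. rewrite <- CV_radius_derive. split. now apply Hf.
  assert (E : F x - PSeries a (x - x0) = F x0 - PSeries a (x0 - x0)).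
  { apply (constant_of_derive_0 (fun x => F x - PSeries a (x - x0)) x0 r); [| easy].
    clear x Hx. intros x Hx. destruct (Hf x Hx) as [H1 H2].
    rewrite CV_radius_derive in H1.
    replace 0 with (minus (f x) (scal 1 (PSeries (PS_derive a) (x - x0)))).
    2:{ rewrite H2. unfold scal, minus, plus, opp; simpl. unfold mult; simpl. ring. }
    apply (is_derive_minus F (fun x => PSeries a (x - x0))). now apply HF.
    apply (is_derive_comp (PSeries a) (fun x => x - x0)).
    now apply is_derive_PSeries. auto_derive; [easy | ring]. }
  replace (x0 - x0) with 0 in E by ring. rewrite PSeries_0 in E. lra.
Qed.

Lemma analytic_antiderivative (F f : R -> R) (x0 : R) :
  locally x0 (fun x => is_derive F x (f x)) -> analytic_at f x0 -> analytic_at F x0.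
Proof.
  intros HF Hf. apply locally_Rabs in HF. destruct HF as [s [Hs HF]].
  apply analytic_at_expansion in Hf. destruct Hf as [a [r [Hr Hf]]].
  apply analytic_at_expansion.
  set (b := fun n => match n with O => F x0 | S k => a k / INR (S k) end).
  exists b, (Rmin r s). split. now apply Rmin_pos.
  apply expansion_antiderivative with f.
  - intros x Hx.
    assert (E : forall n, a n = PS_derive b n).
    { intros n. unfold PS_derive, b. field.
      apply Rgt_not_eq, INR_S_pos. }
    rewrite <- (CV_radius_ext _ _ E), <- (PSeries_ext _ _ _ E). apply Hf.
    eapply Rlt_le_trans; [apply Hx | apply Rmin_l].
  - easy.
  - intros x Hx. apply HF. eapply Rlt_le_trans; [apply Hx | apply Rmin_r].
Qed.

Lemma analytic_continuous (f : R -> R) (x0 : R) : analytic_at f x0 -> continuous f x0.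
Proof.
  intros Hf. apply analytic_at_expansion in Hf. destruct Hf as [a [r [Hr Hf]]].
  apply continuous_ext_loc with (fun x => PSeries a (x - x0)).
  - apply locally_Rabs. exists r. split. easy. intros x Hx. symmetry. now apply Hf.
  - apply (continuous_comp (fun x => x - x0) (PSeries a)).
    + apply (continuous_minus (fun x => x) (fun _ => x0)).
      apply continuous_id. apply continuous_const.
    + apply continuity_pt_filterlim, PSeries_continuity.
      destruct (Hf x0) as [H _]; [| easy].
      replace (x0 - x0) with 0 by ring. now rewrite Rabs_R0.
Qed.

(** The constant coefficient is the limit from the right at 0. Once it vanishes, division by [h]
    leaves the shifted series under the same hypotheses, whence the induction with [a] general. Only
    one-sided vanishing is assumed, as this is what a supremum of bad points provides. *)
Lemma PSeries_zero_right (r : R) : 0 < r -> forall (n : nat) (a : nat -> R),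
  Rbar_lt 0 (CV_radius a) ->
  (forall h, 0 < h < r -> Rbar_lt (Rabs h) (CV_radius a) /\ PSeries a h = 0) ->
  a n = 0.
Proof.
  intros Hr.
  assert (A0 : forall a : nat -> R, Rbar_lt 0 (CV_radius a) ->
    (forall h, 0 < h < r -> Rbar_lt (Rabs h) (CV_radius a) /\ PSeries a h = 0) ->
    a 0%nat = 0).
  { intros a H0 Ha. rewrite <- PSeries_0.
    apply eq_sym, (filterlim_locally_unique (F := at_right 0) (PSeries a)).
    - apply filterlim_ext_loc with (fun _ => 0); [| apply filterlim_const].
      exists (mkposreal r Hr). intros y Hy Hy0. symmetry. apply Ha. split. easy.
      change (Rabs (y - 0) < r) in Hy. rewrite Rabs_pos_eq in Hy; lra.
    - eapply filterlim_filter_le_1; [apply filter_le_within |].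
      apply continuity_pt_filterlim, PSeries_continuity. now rewrite Rabs_R0. }
  induction n as [| n IH]; intros a H0 Ha. now apply A0.
  apply (IH (PS_decr_1 a)).
  - now rewrite CV_radius_decr_1.
  - intros h Hh. rewrite CV_radius_decr_1. destruct (Ha h Hh) as [H1 H2]. split. easy.
    rewrite PSeries_decr_1, A0 in H2; try easy; [| now apply CV_radius_inside].
    destruct (Rmult_integral h (PSeries (PS_decr_1 a) h)); lra.
Qed.

Lemma analytic_zero_right (f : R -> R) (x0 : R) :
  analytic_at f x0 -> at_right x0 (fun x => f x = 0) -> locally x0 (fun x => f x = 0).
Proof.
  intros Hf [e He]. apply analytic_at_expansion in Hf. destruct Hf as [a [r [Hr Hf]]].
  assert (A : forall n, a n = 0).
  { intros n. apply (PSeries_zero_right (Rmin r e)).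
    - apply Rmin_pos. easy. apply cond_pos.
    - destruct (Hf x0) as [H _]; replace (x0 - x0) with 0 in * by ring;
        rewrite Rabs_R0 in *; easy.
    - intros h Hh. assert (h < r) by (apply Rlt_le_trans with (1 := proj2 Hh), Rmin_l).
      assert (h < e) by (apply Rlt_le_trans with (1 := proj2 Hh), Rmin_r).
      replace h with (x0 + h - x0) by ring.
      destruct (Hf (x0 + h)) as [H1 H2].
      { replace (x0 + h - x0) with h by ring. rewrite Rabs_pos_eq; lra. }
      split. easy. rewrite <- H2. apply He; [| lra].
      unfold ball; simpl; unfold AbsRing_ball, abs, minus, plus, opp; simpl.
      rewrite Rabs_pos_eq; lra. }
  apply locally_Rabs. exists r. split. easy. intros x Hx.
  destruct (Hf x Hx) as [_ ->]. rewrite (PSeries_ext _ (fun _ => 0) _ A).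
  apply PSeries_const_0.
Qed.

Lemma analytic_unique (f g : R -> R) :
  (forall x, x < 1 -> analytic_at f x) -> (forall x, x < 1 -> analytic_at g x) ->
  (forall x, Rabs x < 1 -> f x = g x) -> forall x, x < 1 -> f x = g x.
Proof.
  intros Hf Hg H x Hx.
  set (d := fun x => f x + -1 * g x).
  assert (Hd : forall x, x < 1 -> analytic_at d x).
  { intros y Hy. apply analytic_plus. now apply Hf. apply analytic_scal. now apply Hg. }
  enough (D : d x = 0) by (unfold d in D; lra).
  destruct (Rlt_or_le x 0) as [Hx0 | Hx0].
  2:{ unfold d. rewrite H. ring. rewrite Rabs_pos_eq; lra. }
  apply NNPP. intros ND.
  (* At the supremum [c] of the points where [f] and [g] differ, [d] vanishes on the right,
     hence near [c], contradicting the choice of [c]. *)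
  destruct (completeness (fun y => y < 1 /\ d y <> 0)) as [c [Hub Hlub]].
  - exists 0. intros y [Hy Hy']. apply Rnot_lt_le. intros L. apply Hy'.
    unfold d. rewrite H. ring. rewrite Rabs_pos_eq; lra.
  - exists x. split; [lra | easy].
  - assert (Hc0 : c <= 0).
    { apply Hlub. intros y [Hy Hy']. apply Rnot_lt_le. intros L. apply Hy'.
      unfold d. rewrite H. ring. rewrite Rabs_pos_eq; lra. }
    assert (Hz : locally c (fun y => d y = 0)).
    { apply analytic_zero_right. apply Hd. lra.
      assert (P : 0 < 1 - c) by lra. exists (mkposreal _ P). intros y Hy Hcy.
      unfold ball in Hy; simpl in Hy; unfold AbsRing_ball, abs, minus, plus, opp in Hy.
      simpl in Hy. rewrite Rabs_pos_eq in Hy by lra.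
      apply NNPP. intros Hy'. apply (Rlt_not_le y c Hcy). apply Hub. split; [lra | easy]. }
    apply locally_Rabs in Hz. destruct Hz as [r [Hr Hz]].
    assert (c <= c - r).
    { apply Hlub. intros y [Hy Hy']. apply Rnot_lt_le. intros L. apply Hy'.
      assert (y <= c) by now apply Hub. apply Hz. rewrite Rabs_left1; lra. }
    lra.
Qed.

Lemma is_polylog_unique (t : nat) (L1 L2 : R -> R) :
  is_polylog t L1 -> is_polylog t L2 -> forall x, x < 1 -> L1 x = L2 x.
Proof.
  intros [S1 A1] [S2 A2]. apply analytic_unique; try easy.
  intros x Hx. rewrite <- (is_series_unique _ _ (S1 x Hx)). now apply is_series_unique, S2.
Qed.

Lemma is_polylog_0 : is_polylog 0 (fun x => x / (1 - x)).
Proof.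
  split.
  - intros x Hx.
    apply is_series_ext with (fun k => scal x (x ^ k)).
    { intros k. unfold scal; simpl; unfold mult; simpl. field. }
    apply (is_series_scal x _ (/ (1 - x))). now apply is_series_geom.
  - intros x Hx.
    apply analytic_ext_loc with (fun x => -1 * / (x - 1) + -1).
    + generalize (locally_lt x 1 Hx). apply filter_imp. intros y Hy. field. lra.
    + apply analytic_plus. apply analytic_scal, analytic_inv_sub. lra.
      apply analytic_const.
Qed.

(* The next polylogarithm is the antiderivative of [L u / u], whose singularity at 0 is
   removable. *)
Lemma is_polylog_succ (t : nat) (L : R -> R) : is_polylog t L ->
  exists L', is_polylog (S t) L' /\ forall x, x < 0 -> is_derive L' x (L x / x).
Proof.
  intros [HS HA].
  (* The value 1 at 0 is the leading coefficient of every polylogarithm series, so [h] is the sum of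
     the series [a] on [(-1, 1)]. *)
  set (h := fun u => if Req_EM_T u 0 then 1 else L u / u).
  set (a := fun k => / INR (S k) ^ t).
  assert (Ea : has_expansion h 0 a 1).
  { assert (CV : forall x, Rabs (x - 0) < 1 -> Rbar_lt (Rabs (x - 0)) (CV_radius a)).
    { intros x Hx. rewrite Rminus_0_r in *.
      (* A point strictly between [Rabs x] and 1: the terms at [y] tend to 0, so the radius of
         convergence is at least [y]. *)
      set (y := (1 + Rabs x) / 2). assert (0 <= Rabs x) by apply Rabs_pos.
      apply Rbar_lt_le_trans with (Rabs y).
      { simpl. unfold y. rewrite (Rabs_pos_eq (_ / 2)); lra. }
      apply Rbar_not_lt_le. intros Hlt. apply (CV_disk_outside _ _ Hlt).
      apply is_lim_seq_ext with (fun k => / y * (y ^ S k / INR (S k) ^ t)).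
      { intros n. unfold a. generalize (INR_S_pow_neq_0 n t).
        generalize (INR (S n) ^ t). intros d Hd. simpl. field. split. easy.
        unfold y. lra. }
      replace (Finite 0) with (Rbar_mult (/ y) 0) by (simpl; f_equal; ring).
      apply is_lim_seq_scal_l. apply ex_series_lim_0. eexists. apply HS.
      unfold y. rewrite Rabs_pos_eq; lra. }
    intros x Hx. split. now apply CV. specialize (CV x Hx).
    rewrite Rminus_0_r in *. unfold h. destruct (Req_EM_T x 0) as [-> | Nx].
    - rewrite PSeries_0. unfold a. simpl. rewrite pow1. field.
    - apply Rmult_eq_reg_l with x; [| easy].
      replace (x * (L x / x)) with (L x) by (field; easy).
      rewrite <- (is_series_unique _ _ (HS x Hx)). unfold PSeries.
      rewrite <- Series_scal_l. apply Series_ext. intros n. unfold a.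
      generalize (INR_S_pow_neq_0 n t).
      generalize (INR (S n) ^ t). intros d Hd. simpl. field. easy. }
  assert (Ah : forall x, x < 1 -> analytic_at h x).
  { intros x Hx. destruct (Req_dec x 0) as [-> | Nx].
    - apply analytic_at_expansion. exists a, 1. split; [lra | easy].
    - apply analytic_ext_loc with (fun x => L x * / (x - 0)).
      + apply locally_Rabs. exists (Rabs x). split. now apply Rabs_pos_lt.
        intros y Hy. unfold h. rewrite Rminus_0_r. destruct (Req_EM_T y 0) as [-> | Ny].
        rewrite Rminus_0_l, Rabs_Ropp in Hy. lra. easy.
      + apply analytic_mult. now apply HA. now apply analytic_inv_sub. }
  set (L' := fun x => RInt h 0 x).
  assert (D : forall x, x < 1 -> is_derive L' x (h x)).
  { intros x Hx. apply (is_derive_RInt h L' 0 x).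
    - generalize (locally_lt x 1 Hx). apply filter_imp. intros y Hy.
      apply (@RInt_correct R_CompleteNormedModule), (@ex_RInt_continuous R_CompleteNormedModule).
      intros z Hz. apply analytic_continuous, Ah. apply Rle_lt_trans with (1 := proj2 Hz).
      apply Rmax_lub_lt; lra.
    - now apply analytic_continuous, Ah. }
  exists L'. split. split.
  - intros x Hx.
    set (b := fun n => match n with O => 0 | S k => / INR (S k) ^ S t end).
    assert (Eb : has_expansion L' 0 b 1).
    { apply expansion_antiderivative with h.
      - assert (E : forall n, a n = PS_derive b n).
        { intros n. unfold a, PS_derive, b. generalize (INR_S_pow_neq_0 n t).
        generalize (INR_S_pos n). generalize (INR (S n)). intros d Hd Hdt.
        simpl. field. split. easy. lra. }
        intros y Hy. rewrite <- (CV_radius_ext _ _ E), <- (PSeries_ext _ _ _ E). now apply Ea.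
      - unfold L'. now rewrite RInt_point.
      - intros y Hy. apply D. rewrite Rminus_0_r in Hy. apply Rabs_def2 in Hy. lra. }
    destruct (Eb x) as [H1 H2]. now rewrite Rminus_0_r. rewrite Rminus_0_r in *.
    assert (P : is_pseries b x (L' x)).
    { rewrite H2. now apply PSeries_correct, CV_radius_inside. }
    apply is_pseries_R in P.
    (* The series of [is_polylog] starts at exponent 1, so the vanishing term of index 0 is split
       off. *)
    replace (L' x) with (plus (L' x) (b 0%nat * x ^ 0)) in P
      by (unfold b, plus; simpl; ring).
    apply (is_series_incr_1 (fun n => b n * x ^ n)) in P.
    revert P. apply is_series_ext. intros n. unfold b, Rdiv. apply Rmult_comm.
  - intros x Hx. apply analytic_antiderivative with h; [| now apply Ah].
    generalize (locally_lt x 1 Hx). apply filter_imp. apply D.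
  - intros x Hx. replace (L x / x) with (h x). apply D. lra.
    unfold h. destruct (Req_EM_T x 0). lra. easy.
Qed.

(** [epsilon] returns a solution only if one exists; iterating the antiderivative from order 0
    provides it. The choice is unique for [x < 1] only, hence the bounds on arguments below. *)
Lemma polylog_spec (t : nat) : is_polylog t (polylog t).
Proof.
  unfold polylog. apply epsilon_spec. induction t as [| t [L HL]].
  - eexists. apply is_polylog_0.
  - destruct (is_polylog_succ t L HL) as [L' [H _]]. now exists L'.
Qed.

Lemma polylog_0 (x : R) : x < 1 -> polylog 0 x = x / (1 - x).
Proof.
  exact (is_polylog_unique 0 _ _ (polylog_spec 0) is_polylog_0 x).
Qed.

(** The antiderivative built from [polylog t] and the chosen [polylog (S t)] agree near [x] by
    uniqueness. Negative [x] suffices, since the arguments to come are [- exp y]. *)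
Lemma is_derive_polylog (t : nat) (x : R) :
  x < 0 -> is_derive (polylog (S t)) x (polylog t x / x).
Proof.
  intros Hx. destruct (is_polylog_succ t _ (polylog_spec t)) as [L' [H D]].
  apply is_derive_ext_loc with L'; [| now apply D].
  generalize (locally_lt x 0 Hx). apply filter_imp. intros y Hy.
  apply (is_polylog_unique (S t)); [easy | apply polylog_spec | lra].
Qed.

(** * Alternating series and the inversion formula *)

Lemma alternating_series (u : nat -> R) :
  (forall n, u (S n) <= u n) -> is_lim_seq u 0 ->
  exists l, is_series (fun n => (-1) ^ n * u n) l /\ 0 <= l <= u O.
Proof.
  intros Hd Hl. apply is_lim_seq_Reals in Hl.
  destruct (alternated_series u Hd Hl) as [l Hs].
  exists l. split.
  - apply is_series_Reals. exact Hs.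
  - destruct (alternated_series_ineq u l 0 Hd Hl Hs) as [H1 H2].
    unfold tg_alt in *. simpl in *. generalize (Hd O). lra.
Qed.

(** The tail is [(-1) ^ S N] times an alternating series that starts at [u (S N)], so its sum is
    bounded by that first term. *)
Lemma alternating_remainder (u : nat -> R) (l : R) :
  (forall n, u (S n) <= u n) -> is_lim_seq u 0 ->
  is_series (fun n => (-1) ^ n * u n) l ->
  forall N, Rabs (l - sum_n (fun n => (-1) ^ n * u n) N) <= u (S N).
Proof.
  intros Hd Hl Hs N.
  destruct (alternating_series (fun k => u (S N + k)%nat)) as [r [Hr [H0 H1]]].
  - intros n. rewrite <- plus_n_Sm. apply Hd.
  - apply is_lim_seq_ext with (fun k => u (k + S N)%nat).
    intros n. now rewrite Nat.add_comm. now apply (is_lim_seq_incr_n u (S N)).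
  - rewrite Nat.add_0_r in H1.
    assert (E : l - sum_n (fun n => (-1) ^ n * u n) N = (-1) ^ S N * r).
    { assert (T : is_series (fun k => (-1) ^ (S N + k) * u (S N + k)%nat)
                    (l - sum_n (fun n => (-1) ^ n * u n) N)).
      { apply (is_series_incr_n (fun n => (-1) ^ n * u n)). lia. simpl pred.
        match goal with |- is_series _ ?v => replace v with l end. easy.
        assert (K : forall x s : R, x = x - s + s) by (intros; ring). apply K. }
      rewrite <- (is_series_unique _ _ T). apply is_series_unique.
      apply (is_series_scal ((-1) ^ S N)) in Hr.
      revert Hr. apply is_series_ext. intros n.
      rewrite pow_add, Rmult_assoc. reflexivity. }
    rewrite E, Rabs_mult, pow_1_abs, Rmult_1_l. now rewrite Rabs_pos_eq.
Qed.

Lemma is_lim_seq_inv_S_pow (t : nat) : is_lim_seq (fun n => / INR (S n) ^ S t) 0.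
Proof.
  apply is_lim_seq_le_le with (fun _ => 0) (fun n => / INR (S n)).
  - intros n. split. apply Rlt_le, Rinv_0_lt_compat, INR_S_pow_pos.
    apply Rinv_le_contravar. apply INR_S_pos.
    rewrite <- tech_pow_Rmult, <- (Rmult_1_r (INR (S n))) at 1. apply Rmult_le_compat_l.
    apply Rlt_le, INR_S_pos. apply pow_R1_Rle. rewrite S_INR. generalize (pos_INR n). lra.
  - apply is_lim_seq_const.
  - apply (is_lim_seq_incr_1 (fun n => / INR n)).
    replace (Finite 0) with (Rbar_inv p_infty) by easy.
    apply is_lim_seq_inv. apply is_lim_seq_INR. easy.
Qed.

Lemma inv_S_pow_decr (n t : nat) : / INR (S (S n)) ^ t <= / INR (S n) ^ t.
Proof.
  apply Rinv_le_contravar. apply INR_S_pow_pos. apply pow_incr.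
  split. apply pos_INR. apply le_INR. lia.
Qed.

Lemma is_series_eta (s : nat) :
  is_series (fun k => (-1) ^ k * / INR (S k) ^ S s) (eta (S s)).
Proof.
  destruct (alternating_series (fun k => / INR (S k) ^ S s)) as [l [Hl _]].
  - intros n. apply inv_S_pow_decr.
  - apply is_lim_seq_inv_S_pow.
  - unfold eta. rewrite (Series_ext _ (fun k => (-1) ^ k * / INR (S k) ^ S s)).
    2:{ intros k. unfold Rdiv.
        replace (S k + 1)%nat with (k + 2)%nat by lia. rewrite pow_add. ring. }
    apply Series_correct. now exists l.
Qed.

Definition polylog_exp (t : nat) (y : R) : R := polylog t (- exp y).

Lemma polylog_exp_0 (y : R) : polylog_exp 0 y = - exp y / (1 + exp y).
Proof.
  unfold polylog_exp. generalize (exp_pos y). intros H. rewrite polylog_0 by lra.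
  now replace (1 - - exp y) with (1 + exp y) by ring.
Qed.

Lemma is_derive_polylog_exp (t : nat) (y : R) :
  is_derive (polylog_exp (S t)) y (polylog_exp t y).
Proof.
  generalize (exp_pos y). intros H.
  replace (polylog_exp t y) with (scal (- exp y) (polylog t (- exp y) / - exp y)).
  2:{ unfold polylog_exp, scal; simpl; unfold mult; simpl. field. lra. }
  apply (is_derive_comp (polylog (S t)) (fun y => - exp y)).
  - apply is_derive_polylog. lra.
  - auto_derive. easy. ring.
Qed.

Lemma continuous_polylog_exp (t : nat) (y : R) : continuous (polylog_exp t) y.
Proof.
  apply (continuous_comp (fun y => - exp y) (polylog t)).
  - apply (ex_derive_continuous (fun y => - exp y)). auto_derive. easy.
  - apply analytic_continuous. apply polylog_spec. generalize (exp_pos y). lra.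
Qed.

Lemma exp_le (x y : R) : x <= y -> exp x <= exp y.
Proof.
  intros [H | ->]. now apply Rlt_le, exp_increasing. apply Rle_refl.
Qed.

Lemma exp_INR_mult (n : nat) (y : R) : exp (INR n * y) = exp y ^ n.
Proof.
  induction n as [| n IH]. simpl. rewrite Rmult_0_l. apply exp_0.
  rewrite S_INR, Rmult_plus_distr_r, exp_plus, IH, Rmult_1_l. simpl. ring.
Qed.

Lemma is_series_polylog_exp (t : nat) (y : R) : 0 < y ->
  is_series (fun n => (-1) ^ n * (exp (- (INR (S n) * y)) / INR (S n) ^ t))
    (- polylog_exp t (- y)).
Proof.
  intros Hy. assert (E : 0 < exp (- y) < 1).
  { split. apply exp_pos. rewrite <- exp_0. apply exp_increasing. lra. }
  destruct (polylog_spec t) as [HS _].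
  specialize (HS (- exp (- y))). rewrite Rabs_Ropp, Rabs_pos_eq in HS by lra.
  specialize (HS (proj2 E)). apply (is_series_scal (-1)) in HS.
  unfold polylog_exp.
  replace (- polylog t (- exp (- y))) with (scal (-1) (polylog t (- exp (- y))))
    by (unfold scal; simpl; unfold mult; simpl; ring).
  revert HS. apply is_series_ext. intros n.
  rewrite <- Ropp_mult_distr_r_reverse, exp_INR_mult.
  replace (- exp (- y)) with ((-1) * exp (- y)) by ring. rewrite Rpow_mult_distr.
  rewrite <- tech_pow_Rmult.
  change (-1 * (-1 * (-1) ^ n * exp (- y) ^ S n / INR (S n) ^ t)
          = (-1) ^ n * (exp (- y) ^ S n / INR (S n) ^ t)).
  field. apply INR_S_pow_neq_0.
Qed.

Lemma exp_div_pow_decr (t : nat) (y : R) (n : nat) : 0 <= y ->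
  exp (- (INR (S (S n)) * y)) / INR (S (S n)) ^ t <=
  exp (- (INR (S n) * y)) / INR (S n) ^ t.
Proof.
  intros Hy. apply Rmult_le_compat. apply Rlt_le, exp_pos.
  apply Rlt_le, Rinv_0_lt_compat, INR_S_pow_pos.
  2: apply inv_S_pow_decr.
  apply exp_le. apply Ropp_le_contravar, Rmult_le_compat_r. easy. apply le_INR. lia.
Qed.

(** This bound serves twice: it is uniform in [y], which allows the passage [y -> 0], and it is
    integrable against powers of [y], which allows termwise integration. *)
Lemma polylog_exp_remainder (t : nat) (y : R) (N : nat) : 0 < y ->
  Rabs (- polylog_exp t (- y)
        - sum_n (fun n => (-1) ^ n * (exp (- (INR (S n) * y)) / INR (S n) ^ t)) N)
  <= exp (- (INR (S (S N)) * y)) / INR (S (S N)) ^ t.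
Proof.
  intros Hy.
  apply (alternating_remainder
           (fun n => exp (- (INR (S n) * y)) / INR (S n) ^ t)).
  - intros n. apply exp_div_pow_decr. lra.
  - assert (E : 0 < exp (- y) < 1).
    { split. apply exp_pos. rewrite <- exp_0. apply exp_increasing. lra. }
    apply is_lim_seq_le_le with (fun _ => 0) (fun n => exp (- y) * exp (- y) ^ n).
    + intros n. rewrite <- Ropp_mult_distr_r_reverse, exp_INR_mult.
      assert (0 < exp (- y) ^ S n) by (apply pow_lt; lra).
      split. apply Rlt_le, Rdiv_lt_0_compat. easy. apply INR_S_pow_pos.
      rewrite <- tech_pow_Rmult in *. unfold Rdiv.
      rewrite <- (Rmult_1_r (exp (- y) * exp (- y) ^ n)) at 2. apply Rmult_le_compat_l. lra.
      rewrite <- Rinv_1. apply Rinv_le_contravar. lra. apply pow_R1_Rle.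
      rewrite S_INR. generalize (pos_INR n). lra.
    + apply is_lim_seq_const.
    + replace (Finite 0) with (Rbar_mult (exp (- y)) 0) by (simpl; f_equal; ring).
      apply is_lim_seq_scal_l, is_lim_seq_geom. rewrite Rabs_pos_eq; lra.
  - now apply is_series_polylog_exp.
Qed.

(** The argument is [-1], on the boundary of the disk where [is_polylog] gives the series. The
    remainder bound, uniform for [y > 0], passes to [y = 0] by continuity of [polylog_exp] from
    analyticity, as in Abel's theorem. *)
Lemma polylog_exp_at_0 (t : nat) : polylog_exp (S t) 0 = - eta (S t).
Proof.
  enough (H : is_series (fun k => (-1) ^ k * / INR (S k) ^ S t) (- polylog_exp (S t) 0)).
  { apply is_series_unique in H. rewrite (is_series_unique _ _ (is_series_eta t)) in H. lra. }
  set (s := fun y N => sum_n (fun n => (-1) ^ n * (exp (- (INR (S n) * y)) / INR (S n) ^ S t)) N).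
  assert (B : forall N, Rabs (- polylog_exp (S t) 0 - s 0 N) <= / INR (S (S N)) ^ S t).
  { intros N.
    set (f := fun y => Rabs (- polylog_exp (S t) (- y) - s y N)).
    replace (Rabs _) with (f 0) by (unfold f; now rewrite Ropp_0).
    assert (Cf : continuous f 0).
    { apply (continuous_comp (fun y => - polylog_exp (S t) (- y) - s y N) Rabs).
      2: apply continuous_Rabs.
      apply (continuous_minus (fun y => - polylog_exp (S t) (- y)) (fun y => s y N)).
      - apply (continuous_opp (fun y => polylog_exp (S t) (- y))).
        apply (continuous_comp Ropp (polylog_exp (S t))).
        apply (ex_derive_continuous Ropp). auto_derive. easy.
        apply continuous_polylog_exp.
      - apply (ex_derive_continuous (fun y => s y N)). unfold s.
        apply (ex_derive_sum_n (fun n y => (-1) ^ n * (exp (- (INR (S n) * y)) / INR (S n) ^ S t))).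
        intros k Hk. auto_derive. easy. }
    apply (filterlim_le (F := at_right 0) f (fun _ => / INR (S (S N)) ^ S t) (f 0)
             (/ INR (S (S N)) ^ S t)).
    - exists (mkposreal 1 Rlt_0_1). intros y _ Hy.
      eapply Rle_trans. now apply polylog_exp_remainder.
      rewrite <- (Rmult_1_l (/ _)). apply Rmult_le_compat_r.
      apply Rlt_le, Rinv_0_lt_compat, INR_S_pow_pos.
      rewrite <- exp_0. apply exp_le. generalize (INR_S_pos (S N)). intros.
      assert (0 <= INR (S (S N)) * y) by (apply Rmult_le_pos; lra). lra.
    - eapply filterlim_filter_le_1; [| apply Cf]. apply filter_le_within.
    - apply filterlim_const. }
  apply (is_lim_seq_ext (s 0) _ (Finite (- polylog_exp (S t) 0))).
  { intros N. unfold s. apply sum_n_ext. intros n.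
    rewrite Rmult_0_r, Ropp_0, exp_0. unfold Rdiv. now rewrite Rmult_1_l. }
  apply (is_lim_seq_ext (fun N => - polylog_exp (S t) 0 - (- polylog_exp (S t) 0 - s 0 N))).
  { intros N. change (@eq R (- polylog_exp (S t) 0 - (- polylog_exp (S t) 0 - s 0 N)) (s 0 N)). ring. }
  replace (Finite (- polylog_exp (S t) 0)) with (Finite (- polylog_exp (S t) 0 - 0))
    by (f_equal; ring).
  apply is_lim_seq_minus'. apply is_lim_seq_const.
  apply is_lim_seq_abs_0.
  apply is_lim_seq_le_le with (fun _ => 0) (fun N => / INR (S (S N)) ^ S t).
  - intros N. split. apply Rabs_pos. apply B.
  - apply is_lim_seq_const.
  - apply (is_lim_seq_incr_1 (fun N => / INR (S N) ^ S t)), is_lim_seq_inv_S_pow.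
Qed.

Definition inversion_poly (t : nat) (y : R) : R :=
  sum_n (fun j => eta (2 * j) * (y ^ (t - 2 * j) / INR (fact (t - 2 * j)))) (t / 2).

Lemma is_derive_pow_fact (n : nat) (y : R) :
  is_derive (fun y => y ^ S n / INR (fact (S n))) y (y ^ n / INR (fact n)).
Proof.
  replace (y ^ n / INR (fact n)) with (/ INR (fact (S n)) * (INR (S n) * 1 * y ^ n)).
  2:{ rewrite fact_simpl, mult_INR. field.
      split. apply INR_fact_neq_0. apply Rgt_not_eq, INR_S_pos. }
  apply is_derive_ext with (fun y => / INR (fact (S n)) * y ^ S n).
  { intros z. apply Rmult_comm. }
  apply is_derive_scal, (is_derive_pow (fun y => y) (S n) y 1), (@is_derive_id R_AbsRing).
Qed.

(** For even [t] both sums have the same length. For odd [t] the sum of order [S t] has one more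
    term, the constant [eta (S t)], which differentiation kills. *)
Lemma is_derive_inversion_poly (t : nat) (y : R) :
  is_derive (inversion_poly (S t)) y (inversion_poly t y).
Proof.
  assert (T : forall j, (2 * j <= t)%nat ->
    is_derive (fun y => eta (2 * j) * (y ^ (S t - 2 * j) / INR (fact (S t - 2 * j)))) y
      (eta (2 * j) * (y ^ (t - 2 * j) / INR (fact (t - 2 * j))))).
  { intros j Hj. replace (S t - 2 * j)%nat with (S (t - 2 * j)) by lia.
    apply is_derive_scal, is_derive_pow_fact. }
  unfold inversion_poly.
  destruct (Nat.Even_or_Odd t) as [[s Hs] | [s Hs]].
  - replace (S t / 2)%nat with s by (subst; apply (Nat.div_unique _ _ _ 1); lia).
    replace (t / 2)%nat with s by (subst; apply (Nat.div_unique _ _ _ 0); lia).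
    apply (is_derive_sum_n (fun j y => eta (2 * j) * (y ^ (S t - 2 * j) / INR (fact (S t - 2 * j))))).
    intros k Hk. apply T. lia.
  - replace (S t / 2)%nat with (S s) by (subst; apply (Nat.div_unique _ _ _ 0); lia).
    replace (t / 2)%nat with s by (subst; apply (Nat.div_unique _ _ _ 1); lia).
    apply is_derive_ext with (fun y =>
      sum_n (fun j => eta (2 * j) * (y ^ (S t - 2 * j) / INR (fact (S t - 2 * j)))) s
      + eta (2 * S s)).
    { intros z. rewrite sum_Sn. unfold plus; simpl plus.
      replace (S t - 2 * S s)%nat with O by lia. simpl pow. simpl fact. simpl INR.
      replace (1 / 1) with 1 by field. rewrite Rmult_1_r. easy. }
    match goal with |- is_derive _ _ ?v => replace v with (plus v 0) at 1 end.
    2: unfold plus; simpl; ring.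
    apply (is_derive_plus (fun y => sum_n _ s) (fun _ => eta (2 * S s))).
    2: auto_derive; easy.
    apply (is_derive_sum_n (fun j y => eta (2 * j) * (y ^ (S t - 2 * j) / INR (fact (S t - 2 * j))))).
    intros k Hk. apply T. lia.
Qed.

(** This fixes the constant of integration. For odd order both sides vanish; for even order only the
    last summand survives, through [0 ^ 0 = 1]. *)
Lemma inversion_poly_at_0 (t : nat) :
  polylog_exp (S t) 0 + (-1) ^ S t * polylog_exp (S t) 0 = -2 * inversion_poly (S t) 0.
Proof.
  assert (Z : forall N, (2 * N < S t)%nat ->
    sum_n (fun j => eta (2 * j) * (0 ^ (S t - 2 * j) / INR (fact (S t - 2 * j)))) N = 0).
  { intros N HN. rewrite (sum_n_ext_loc _ (fun _ => 0)).
    rewrite sum_n_const. apply Rmult_0_r.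
    intros n Hn. rewrite pow_i by lia. unfold Rdiv. now rewrite Rmult_0_l, Rmult_0_r. }
  unfold inversion_poly. rewrite polylog_exp_at_0.
  destruct (Nat.Even_or_Odd (S t)) as [[s Hs] | [s Hs]].
  - replace (S t / 2)%nat with s by (rewrite Hs; apply (Nat.div_unique _ _ _ 0); lia).
    destruct s as [| s]. lia. rewrite sum_Sn, Z by lia.
    replace (S t - 2 * S s)%nat with O by lia. rewrite <- Hs.
    replace ((-1) ^ S t) with 1 by (rewrite Hs; symmetry; apply pow_1_even).
    unfold plus; simpl. field.
  - replace (S t / 2)%nat with s by (rewrite Hs; apply (Nat.div_unique _ _ _ 1); lia).
    rewrite Z by lia. rewrite Hs, Nat.add_1_r. rewrite pow_1_odd. ring.
Qed.

(** Induction on the order: both sides have equal derivatives and equal values at 0. At order 0 the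
    left side is the constant -1, which matches [-2 * eta 0]; this is where the value 1/2 of [eta 0]
    enters. *)
Lemma polylog_exp_inversion (t : nat) (y : R) :
  polylog_exp t y + (-1) ^ t * polylog_exp t (- y) = -2 * inversion_poly t y.
Proof.
  revert y. induction t as [| t IH]; intros y.
  - rewrite !polylog_exp_0, exp_Ropp. unfold inversion_poly. simpl. rewrite sum_O.
    simpl. generalize (exp_pos y). intros. field. lra.
  - set (w := fun y => polylog_exp (S t) y + (-1) ^ S t * polylog_exp (S t) (- y)
                       + 2 * inversion_poly (S t) y).
    enough (w y = 0) by (unfold w in *; lra).
    transitivity (w 0).
    + apply (constant_of_derive_0 w 0 (Rabs y + 1)).
      * intros x _.
        replace 0 with (plus (plus (polylog_exp t x)
          ((-1) ^ S t * scal (-1) (polylog_exp t (- x)))) (2 * inversion_poly t x)).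
        2:{ unfold plus, scal; simpl; unfold mult; simpl.
            generalize (IH x). lra. }
        unfold w.
        apply (is_derive_plus (fun y => polylog_exp (S t) y + (-1) ^ S t * polylog_exp (S t) (- y))
                 (fun y => 2 * inversion_poly (S t) y)).
        apply (is_derive_plus (polylog_exp (S t)) (fun y => (-1) ^ S t * polylog_exp (S t) (- y))).
        apply is_derive_polylog_exp. apply is_derive_scal.
        apply (is_derive_comp (polylog_exp (S t)) (fun x => - x)).
        apply is_derive_polylog_exp. auto_derive. easy. ring.
        apply is_derive_scal, is_derive_inversion_poly.
      * rewrite Rminus_0_r. generalize (Rabs_pos y). lra.
    + unfold w. rewrite Ropp_0. generalize (inversion_poly_at_0 t). lra.
Qed.

(** * Improper integrals over the positive half-line *)

(** Starting exactly at 0 reduces linearity and comparison to facts on compact intervals. Existence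
    on each of these is part of the notion because [RInt] is total. The passage to [RInt_gen]
    happens only for [Gamma] and for the final integral. *)
Definition is_improper (f : R -> R) (l : R) : Prop :=
  (forall M, 0 <= M -> ex_RInt f 0 M) /\ is_lim (RInt f 0) p_infty l.

Lemma is_lim_ext_pos (f g : R -> R) (l : Rbar) :
  (forall x, 0 < x -> f x = g x) -> is_lim f p_infty l -> is_lim g p_infty l.
Proof.
  intros H. apply is_lim_ext_loc. exists 0. exact H.
Qed.

Lemma is_improper_ext (f g : R -> R) (l : R) :
  (forall x, 0 < x -> f x = g x) -> is_improper f l -> is_improper g l.
Proof.
  intros H [E L]. split.
  - intros M HM. apply ex_RInt_ext with f; [| now apply E].
    intros x Hx. apply H. rewrite Rmin_left in Hx by easy. apply Hx.
  - revert L. apply is_lim_ext_pos. intros M HM. apply RInt_ext.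
    intros x Hx. apply H. rewrite Rmin_left in Hx by lra. apply Hx.
Qed.

Lemma is_improper_plus (f g : R -> R) (l m : R) :
  is_improper f l -> is_improper g m -> is_improper (fun x => f x + g x) (l + m).
Proof.
  intros [E1 L1] [E2 L2]. split.
  - intros M HM. apply (ex_RInt_plus f g). now apply E1. now apply E2.
  - apply is_lim_ext_pos with (fun M => RInt f 0 M + RInt g 0 M).
    + intros M HM. symmetry. apply (RInt_plus f g). apply E1; lra. apply E2; lra.
    + now apply is_lim_plus'.
Qed.

Lemma is_improper_scal (c : R) (f : R -> R) (l : R) :
  is_improper f l -> is_improper (fun x => c * f x) (c * l).
Proof.
  intros [E1 L1]. split.
  - intros M HM. apply (ex_RInt_scal f). now apply E1.
  - apply is_lim_ext_pos with (fun M => c * RInt f 0 M).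
    + intros M HM. symmetry. apply (RInt_scal f). apply E1; lra.
    + apply (is_lim_scal_l (RInt f 0) c p_infty l L1).
Qed.

Lemma is_improper_sum_n (f : nat -> R -> R) (v : nat -> R) (n : nat) :
  (forall k, is_improper (f k) (v k)) ->
  is_improper (fun x => sum_n (fun k => f k x) n) (sum_n v n).
Proof.
  intros H. induction n as [| n IH].
  - rewrite sum_O. apply is_improper_ext with (f O); [| apply H].
    intros x _. now rewrite sum_O.
  - rewrite sum_Sn.
    apply is_improper_ext with (fun x => sum_n (fun k => f k x) n + f (S n) x).
    intros x _. now rewrite sum_Sn.
    now apply (is_improper_plus (fun x => sum_n (fun k => f k x) n)).
Qed.

Lemma is_improper_partial_le (f : R -> R) (l M : R) :
  (forall x, 0 < x -> 0 <= f x) -> is_improper f l -> 0 <= M -> RInt f 0 M <= l.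
Proof.
  intros Hf [E L] HM.
  apply (is_lim_le_loc (fun _ => RInt f 0 M) (RInt f 0) p_infty (RInt f 0 M) l); [| | easy].
  2: apply is_lim_const.
  exists M. intros K HK.
  assert (EK : ex_RInt f M K).
  { apply (ex_RInt_Chasles_2 f 0). lra. apply E; lra. }
  rewrite <- (RInt_Chasles f 0 M K); [| now apply E | easy].
  assert (0 <= RInt f M K); [| unfold plus; simpl; lra].
  apply RInt_ge_0. lra. easy. intros x Hx. apply Hf. lra.
Qed.

Lemma Rabs_def2_le (x a : R) : Rabs x <= a -> - a <= x <= a.
Proof. intros H. now apply Rabs_le_between. Qed.

(** [h] dominates an absolute value, hence is nonnegative, and its partial integrals stay below [B].
    The bound is uniform in [M], as the exchange of limits requires. *)
Lemma RInt_close (f g h : R -> R) (B : R) :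
  (forall M, 0 <= M -> ex_RInt f 0 M) -> (forall M, 0 <= M -> ex_RInt g 0 M) ->
  is_improper h B -> (forall x, 0 < x -> Rabs (f x - g x) <= h x) ->
  forall M, 0 <= M -> Rabs (RInt f 0 M - RInt g 0 M) <= B.
Proof.
  intros Ef Eg Hh H M HM.
  apply Rle_trans with (RInt h 0 M).
  2:{ apply is_improper_partial_le; try easy. intros x Hx. eapply Rle_trans; [| now apply H].
      apply Rabs_pos. }
  assert (Eh : ex_RInt h 0 M) by now apply Hh.
  assert (K1 : RInt f 0 M <= RInt (fun x => plus (g x) (h x)) 0 M).
  { apply RInt_le; auto. apply (ex_RInt_plus g h); auto.
    intros x Hx. unfold plus; simpl. generalize (Rabs_def2_le _ _ (H x (proj1 Hx))). lra. }
  assert (K2 : RInt (fun x => minus (g x) (h x)) 0 M <= RInt f 0 M).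
  { apply RInt_le; auto. apply (ex_RInt_minus g h); auto.
    intros x Hx. unfold minus, plus, opp; simpl.
    generalize (Rabs_def2_le _ _ (H x (proj1 Hx))). lra. }
  rewrite (RInt_plus g h) in K1 by auto. rewrite (RInt_minus g h) in K2 by auto.
  unfold minus, plus, opp in *; simpl in *. apply Rabs_le. lra.
Qed.

Lemma Rabs_lim_le (f : R -> R) (l B : R) :
  is_lim f p_infty l -> (forall x, 0 < x -> Rabs (f x) <= B) -> Rabs l <= B.
Proof.
  intros L H.
  apply (is_lim_le_loc (fun x => Rabs (f x)) (fun _ => B) p_infty (Rabs l) B).
  - exists 0. exact H.
  - apply (is_lim_Rabs _ _ _ L).
  - apply is_lim_const.
Qed.

(** Exchange of the limits in [M] and in [N]. The errors [B N] bound all partial integrals uniformly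
    and tend to 0, which makes [v] a Cauchy sequence and carries its limit over to [f]; no dominated
    convergence theorem is involved. *)
Lemma is_improper_limit (f : R -> R) (s h : nat -> R -> R) (v B : nat -> R) :
  (forall M, 0 <= M -> ex_RInt f 0 M) ->
  (forall N, is_improper (s N) (v N)) -> (forall N, is_improper (h N) (B N)) ->
  (forall N x, 0 < x -> Rabs (f x - s N x) <= h N x) ->
  is_lim_seq B 0 ->
  exists l : R, is_lim_seq v l /\ is_improper f l.
Proof.
  intros Ef Hs Hh H HB.
  assert (K : forall N M, 0 <= M -> Rabs (RInt f 0 M - RInt (s N) 0 M) <= B N).
  { intros N. apply RInt_close with (h N); auto. apply Hs. }
  assert (BN : forall eps : posreal, exists N, forall n, (N <= n)%nat -> B n < eps).
  { intros eps. apply is_lim_seq_spec in HB. destruct (HB eps) as [N HN].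
    exists N. intros n Hn. specialize (HN n Hn). rewrite Rminus_0_r in HN.
    apply Rabs_def2 in HN. lra. }
  assert (C : ex_finite_lim_seq v).
  { apply ex_lim_seq_cauchy_corr. intros eps.
    destruct (BN (pos_div_2 eps)) as [N HN]. exists N. intros n m Hn Hm.
    apply Rle_lt_trans with (B n + B m).
    2:{ generalize (HN n Hn) (HN m Hm). simpl. lra. }
    (* [v n] and [v m] are compared through [f] on [[0, M]], and then [M] tends to infinity. *)
    apply Rabs_lim_le with (fun M => RInt (s n) 0 M - RInt (s m) 0 M).
    - apply is_lim_minus'. apply Hs. apply Hs.
    - intros M HM. generalize (K n M (Rlt_le _ _ HM)) (K m M (Rlt_le _ _ HM)). intros K1 K2.
      apply Rabs_def2_le in K1, K2. apply Rabs_le. lra. }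
  destruct C as [l Hl]. exists l. split. easy. split. easy.
  apply is_lim_spec. intros eps. simpl.
  (* Three errors below [eps / 4] each: from [f] to [s n], from [s n] to [v n], and from [v n] to
     [l]. *)
  destruct (BN (pos_div_2 (pos_div_2 eps))) as [N HN].
  apply is_lim_seq_spec in Hl. destruct (Hl (pos_div_2 (pos_div_2 eps))) as [N' HN'].
  set (n := max N N').
  generalize (HN n (Nat.le_max_l _ _)) (HN' n (Nat.le_max_r _ _)). intros J1 J2.
  destruct (Hs n) as [_ Ln]. apply is_lim_spec in Ln.
  destruct (Ln (pos_div_2 (pos_div_2 eps))) as [M0 HM0].
  exists (Rmax 0 M0). intros M HM.
  assert (HM1 : 0 < M) by (eapply Rle_lt_trans; [apply Rmax_l | apply HM]).
  assert (HM2 : M0 < M) by (eapply Rle_lt_trans; [apply Rmax_r | apply HM]).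
  generalize (HM0 M HM2) (K n M (Rlt_le _ _ HM1)). intros J3 J4. simpl in *.
  apply Rabs_def2 in J2, J3. apply Rabs_def2_le in J4. apply Rabs_def1; lra.
Qed.

Lemma ex_RInt_cont (f : R -> R) (a b : R) : (forall x, continuous f x) -> ex_RInt f a b.
Proof.
  intros H. apply (@ex_RInt_continuous R_CompleteNormedModule). intros z _. apply H.
Qed.

Lemma is_lim_pow_exp (n : nat) (c : R) : 0 < c ->
  is_lim (fun x => x ^ n * exp (- (c * x))) p_infty 0.
Proof.
  intros Hc. set (d := c / INR (S n)).
  assert (Hd : 0 < d) by (apply Rdiv_lt_0_compat; [easy | apply INR_S_pos]).
  apply (is_lim_le_le_loc (fun _ => 0) (fun x => / d ^ S n * / x)).
  - exists 0. intros x Hx. assert (0 < x ^ n) by now apply pow_lt.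
    assert (0 < d * x) by now apply Rmult_lt_0_compat.
    assert (0 < (d * x) ^ S n) by now apply pow_lt.
    split. { apply Rmult_le_pos. lra. apply Rlt_le, exp_pos. }
    replace (/ d ^ S n * / x) with (x ^ n * / (d * x) ^ S n).
    2:{ rewrite Rpow_mult_distr. rewrite <- (tech_pow_Rmult x). field.
        repeat split; try lra. apply pow_nonzero; lra. }
    apply Rmult_le_compat_l. lra. rewrite exp_Ropp. apply Rinv_le_contravar. easy.
    replace (c * x) with (INR (S n) * (d * x)).
    2:{ unfold d. field. apply Rgt_not_eq, INR_S_pos. }
    rewrite exp_INR_mult. apply pow_incr. split. lra.
    generalize (exp_ineq1_le (d * x)). lra.
  - apply is_lim_const.
  - replace (Finite 0) with (Rbar_mult (/ d ^ S n) 0) by (simpl; f_equal; ring).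
    apply is_lim_scal_l. replace (Finite 0) with (Rbar_inv p_infty) by easy.
    apply is_lim_inv. apply is_lim_id. easy.
Qed.

(** Integration by parts: [- / c * x ^ (n+1) * exp (- c x)] is an antiderivative of the integrand of
    order [n + 1] minus [(n+1) / c] times that of order [n], and its boundary values vanish. *)
Lemma is_improper_pow_exp (n : nat) (c : R) : 0 < c ->
  is_improper (fun x => x ^ n * exp (- (c * x))) (INR (fact n) / c ^ S n).
Proof.
  intros Hc.
  assert (E : forall n M, ex_RInt (fun x => x ^ n * exp (- (c * x))) 0 M).
  { intros k M. apply ex_RInt_cont. intros x.
    apply (ex_derive_continuous (fun x => x ^ k * exp (- (c * x)))). auto_derive. easy. }
  induction n as [| n [_ IH]]; split; try (intros M _; apply E).
  - apply is_lim_ext with (fun M => / c - / c * (M ^ 0 * exp (- (c * M)))).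
    + intros M. symmetry. apply is_RInt_unique.
      replace (/ c - / c * (M ^ 0 * exp (- (c * M)))) with
        (minus (- / c * exp (- (c * M))) (- / c * exp (- (c * 0)))).
      2:{ rewrite Rmult_0_r, Ropp_0, exp_0. unfold minus, plus, opp; simpl. ring. }
      apply (is_RInt_derive (fun x => - / c * exp (- (c * x)))).
      * intros x _. auto_derive. easy. simpl. field. lra.
      * intros x _. apply (ex_derive_continuous (fun x => x ^ 0 * exp (- (c * x)))).
        auto_derive. easy.
    + replace (INR (fact 0) / c ^ 1) with (/ c - / c * 0) by (simpl; field; lra).
      apply is_lim_minus'. apply is_lim_const.
      apply (is_lim_scal_l _ (/ c) p_infty 0). now apply is_lim_pow_exp.
  - apply is_lim_ext with (fun M => INR (S n) / c * RInt (fun x => x ^ n * exp (- (c * x))) 0 M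
       - / c * (M ^ S n * exp (- (c * M)))).
    + intros M.
      set (g := fun x => x ^ n * exp (- (c * x))).
      set (f := fun x => x ^ S n * exp (- (c * x))).
      assert (I : is_RInt (fun x => f x - INR (S n) / c * g x) 0 M
                 (- / c * f M - - / c * f 0)).
      { apply (is_RInt_derive (fun x => - / c * f x)).
        - intros x _.
          replace (f x - INR (S n) / c * g x) with
            (- / c * (INR (S n) * 1 * x ^ n * exp (- (c * x)) + x ^ S n * (- c * exp (- (c * x))))).
          2:{ unfold f, g. rewrite <- tech_pow_Rmult. field. lra. }
          apply is_derive_scal. apply (is_derive_mult (fun x => x ^ S n) (fun x => exp (- (c * x)))).
          apply (is_derive_pow (fun y => y) (S n) x 1), (@is_derive_id R_AbsRing).
          auto_derive. easy. ring. intros; apply Rmult_comm.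
        - intros x _. apply (ex_derive_continuous (fun x => f x - INR (S n) / c * g x)).
          unfold f, g. auto_derive. easy. }
      assert (J : is_RInt (fun x => f x - INR (S n) / c * g x) 0 M
                 (RInt f 0 M - INR (S n) / c * RInt g 0 M)).
      { apply (is_RInt_minus f (fun x => INR (S n) / c * g x)).
        apply (@RInt_correct R_CompleteNormedModule), E.
        apply (is_RInt_scal g). apply (@RInt_correct R_CompleteNormedModule), E. }
      apply (@is_RInt_unique R_CompleteNormedModule) in I, J. rewrite I in J. unfold f at 2 in J.
      rewrite pow_i in J by lia. change (M ^ S n * exp (- (c * M))) with (f M).
      rewrite Rmult_0_l, Rmult_0_r in J.
      enough (T : forall a b d : R, d - 0 = a - b -> b + d = a).
      { generalize (T _ _ _ J). intros T'.
        rewrite <- T'. rewrite <- Ropp_mult_distr_l. reflexivity. }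
      intros. lra.
    + replace (INR (fact (S n)) / c ^ S (S n)) with
        (INR (S n) / c * (INR (fact n) / c ^ S n) - / c * 0).
      2:{ rewrite fact_simpl, mult_INR, <- (tech_pow_Rmult c (S n)). field. split.
          apply pow_nonzero. lra. lra. }
      apply is_lim_minus'. apply (is_lim_scal_l _ _ p_infty (INR (fact n) / c ^ S n) IH).
      apply (is_lim_scal_l _ (/ c) p_infty 0). now apply is_lim_pow_exp.
Qed.

(** * Termwise integration *)

Lemma is_series_lim_scal (a : nat -> R) (c l : R) : c <> 0 ->
  is_lim_seq (fun N => sum_n (fun n => c * a n) N) l -> is_series a (l / c).
Proof.
  intros Hc H. generalize (is_series_scal (/ c) (fun n => c * a n) l H). clear H.
  replace (l / c) with (scal (/ c) l) by apply Rmult_comm.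
  apply is_series_ext. intros n.
  change (/ c * (c * a n) = a n). field. easy.
Qed.

(** The inner sum over [j] of the double series for [J], where [c = q n]: an alternating Hurwitz
    zeta function at [c + 1]. *)
Definition alt_hurwitz (m : nat) (c : R) : R :=
  Series (fun j => (-1) ^ j * / (c + INR (S j)) ^ m).

Lemma is_series_alt_hurwitz (m : nat) (c : R) : 0 <= c ->
  is_series (fun j => (-1) ^ j * / (c + INR (S j)) ^ S m) (alt_hurwitz (S m) c).
Proof.
  intros Hc. apply Series_correct.
  destruct (alternating_series (fun j => / (c + INR (S j)) ^ S m)) as [l [Hl _]].
  - intros n. generalize (INR_S_pos n). intros Hn. apply Rinv_le_contravar.
    apply pow_lt. lra. apply pow_incr. split. lra. rewrite (S_INR (S n)). lra.
  - apply is_lim_seq_le_le with (fun _ => 0) (fun n => / INR (S n) ^ S m).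
    + intros n. generalize (INR_S_pos n). intros Hn. split.
      apply Rlt_le, Rinv_0_lt_compat, pow_lt. lra.
      apply Rinv_le_contravar. now apply pow_lt. apply pow_incr. lra.
    + apply is_lim_seq_const.
    + apply is_lim_seq_inv_S_pow.
  - now exists l.
Qed.

Lemma alt_hurwitz_0 (m : nat) : alt_hurwitz (S m) 0 = eta (S m).
Proof.
  rewrite <- (is_series_unique _ _ (is_series_eta m)). apply Series_ext.
  intros n. now rewrite Rplus_0_l.
Qed.

(** With [z = exp (- x)] the partial sum is geometric, and the remainder is exactly
    [(-1)^(N+1) z^(N+2) / (1 + z)]. *)
Lemma fermi_remainder (x : R) (N : nat) :
  Rabs (/ (1 + exp x) - sum_n (fun j => (-1) ^ j * exp (- (INR (S j) * x))) N)
  <= exp (- (INR (S (S N)) * x)).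
Proof.
  assert (E : forall j, exp (- (INR (S j) * x)) = exp (- x) ^ S j).
  { intros j. rewrite <- Ropp_mult_distr_r_reverse. apply exp_INR_mult. }
  assert (Hz : 0 < exp (- x)) by apply exp_pos.
  assert (Ex : exp x = / exp (- x)) by (rewrite exp_Ropp, Rinv_inv; easy).
  rewrite E, Ex. set (z := exp (- x)) in *.
  assert (S : forall N, sum_n (fun j => (-1) ^ j * exp (- (INR (S j) * x))) N
            = z / (1 + z) * (1 - (-1) ^ S N * z ^ S N)).
  { clear N. intros N. induction N as [| N IH].
    - rewrite sum_O, E. change ((-1) ^ 0 * z ^ 1 = z / (1 + z) * (1 - (-1) ^ 1 * z ^ 1)).
      simpl. field. lra.
    - rewrite sum_Sn, IH, E.
      change (z / (1 + z) * (1 - (-1) ^ S N * z ^ S N) + (-1) ^ S N * z ^ S (S N)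
              = z / (1 + z) * (1 - (-1) ^ S (S N) * z ^ S (S N))).
      simpl. field. lra. }
  rewrite S.
  replace (/ (1 + / z) - z / (1 + z) * (1 - (-1) ^ Datatypes.S N * z ^ Datatypes.S N))
    with ((-1) ^ Datatypes.S N * (/ (1 + z) * z ^ Datatypes.S (Datatypes.S N)))
    by (simpl; field; lra).
  rewrite Rabs_mult, pow_1_abs, Rmult_1_l.
  assert (0 < z ^ Datatypes.S (Datatypes.S N)) by now apply pow_lt.
  assert (I : 0 < / (1 + z) <= 1).
  { split. apply Rinv_0_lt_compat. lra. rewrite <- Rinv_1. apply Rinv_le_contravar; lra. }
  rewrite Rabs_pos_eq.
  - rewrite <- (Rmult_1_l (z ^ _)) at 2. apply Rmult_le_compat_r; lra.
  - apply Rmult_le_pos; lra.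
Qed.

(** These are the integrals of the majorants [x^s exp (- (c + d (N+2)) x)]. Two instances are
    needed: [d = 1] for the Fermi factor, and [c = 0], [d = q] for the polylogarithm. *)
Lemma is_lim_seq_fact_div (s : nat) (c d : R) : 0 <= c -> 0 < d ->
  is_lim_seq (fun N => INR (fact s) / (c + d * INR (S (S N))) ^ S s) 0.
Proof.
  intros Hc Hd.
  apply is_lim_seq_le_le with (fun _ => 0)
    (fun N => INR (fact s) / d ^ S s * / INR (S (S N)) ^ S s).
  - intros n. generalize (INR_S_pos (S n)) (INR_fact_lt_0 s). intros Hn Hf.
    assert (0 < d * INR (S (S n))) by now apply Rmult_lt_0_compat. split.
    + apply Rlt_le, Rdiv_lt_0_compat. easy. apply pow_lt. lra.
    + replace (INR (fact s) / d ^ S s * / INR (S (S n)) ^ S s) with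
        (INR (fact s) * / (d * INR (S (S n))) ^ S s).
      2:{ rewrite Rpow_mult_distr, Rinv_mult. unfold Rdiv. ring. }
      apply Rmult_le_compat_l. lra. apply Rinv_le_contravar. now apply pow_lt.
      apply pow_incr. lra.
  - apply is_lim_seq_const.
  - replace (Finite 0) with (Rbar_mult (INR (fact s) / d ^ S s) 0) by (simpl; f_equal; ring).
    apply is_lim_seq_scal_l.
    apply (is_lim_seq_incr_1 (fun N => / INR (S N) ^ S s)), is_lim_seq_inv_S_pow.
Qed.

(** At [c = 0] this gives the moments of the Fermi factor, hence the eta values multiplying powers
    of [q]; at [c = q n] it gives the inner sums of [J]. *)
Lemma is_improper_fermi (s : nat) (c : R) : 0 <= c ->
  is_improper (fun x => x ^ s * exp (- (c * x)) * / (1 + exp x))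
    (INR (fact s) * alt_hurwitz (S s) c).
Proof.
  intros Hc.
  set (v := fun j => INR (fact s) * ((-1) ^ j * / (c + INR (S j)) ^ S s)).
  destruct (is_improper_limit (fun x => x ^ s * exp (- (c * x)) * / (1 + exp x))
    (fun N x => sum_n (fun j => (-1) ^ j * (x ^ s * exp (- ((c + INR (S j)) * x)))) N)
    (fun N x => x ^ s * exp (- ((c + INR (S (S N))) * x)))
    (fun N => sum_n v N)
    (fun N => INR (fact s) / (c + INR (S (S N))) ^ S s)) as [l [Hl Hi]].
  - intros M _. apply ex_RInt_cont. intros x.
    apply (ex_derive_continuous (fun x => x ^ s * exp (- (c * x)) * / (1 + exp x))).
    auto_derive. generalize (exp_pos x). lra.
  - intros N. apply (is_improper_sum_n (fun j x => (-1) ^ j * (x ^ s * exp (- ((c + INR (S j)) * x))))).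
    intros k. replace (v k) with ((-1) ^ k * (INR (fact s) / (c + INR (S k)) ^ S s))
      by (unfold v, Rdiv; ring).
    apply is_improper_scal, is_improper_pow_exp. generalize (INR_S_pos k). lra.
  - intros N. apply is_improper_pow_exp. generalize (INR_S_pos (S N)). lra.
  - intros N x Hx.
    assert (P : 0 < x ^ s * exp (- (c * x))).
    { apply Rmult_lt_0_compat. now apply pow_lt. apply exp_pos. }
    assert (Q : forall j, x ^ s * exp (- ((c + INR (S j)) * x)) =
                x ^ s * exp (- (c * x)) * exp (- (INR (S j) * x))).
    { intros j. rewrite Rmult_assoc, <- exp_plus. do 2 f_equal. ring. }
    rewrite (sum_n_ext _ (fun j => mult (x ^ s * exp (- (c * x))) ((-1) ^ j * exp (- (INR (S j) * x))))).
    2:{ intros j. rewrite Q. unfold mult; simpl Ring.mult.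
        change (@eq R ((-1) ^ j * (x ^ s * exp (- (c * x)) * exp (- (INR (S j) * x))))
           (x ^ s * exp (- (c * x)) * ((-1) ^ j * exp (- (INR (S j) * x))))). ring. }
    rewrite (sum_n_mult_l (x ^ s * exp (- (c * x)))).
    change (mult ?a ?b) with (a * b). rewrite <- Rmult_minus_distr_l.
    rewrite Rabs_mult, Q, (Rabs_pos_eq (x ^ s * _)) by lra.
    apply Rmult_le_compat_l. lra. apply fermi_remainder.
  - apply is_lim_seq_ext with (fun N => INR (fact s) / (c + 1 * INR (S (S N))) ^ S s).
    { intros n. now rewrite Rmult_1_l. }
    apply is_lim_seq_fact_div; lra.
  - apply is_series_lim_scal in Hl. 2: apply INR_fact_neq_0.
    unfold alt_hurwitz. rewrite (is_series_unique _ _ Hl).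
    replace (INR (fact s) * (l / INR (fact s))) with l by (field; apply INR_fact_neq_0).
    exact Hi.
Qed.

(** The weight [w] is either 1 or the Fermi factor. As [w <= 1] and [1 / (N+2)^t <= 1], the majorant
    [x^s exp (- q (N+2) x)] serves for both. The factor -1 inside the proof matches the sign of the
    series, which represents [- polylog_exp]. *)
Lemma is_improper_polylog_exp (s t : nat) (q : R) (w : R -> R) (v : nat -> R) : 0 < q ->
  (forall x, continuous w x) -> (forall x, 0 < x -> 0 <= w x <= 1) ->
  (forall n, is_improper (fun x => x ^ s * exp (- (q * INR (S n) * x)) * w x) (v n)) ->
  exists l, is_improper (fun x => x ^ s * polylog_exp t (- (q * x)) * w x) l /\
    is_series (fun n => (-1) ^ n * (v n / INR (S n) ^ t)) (- l).
Proof.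
  intros Hq Cw Bw Hv.
  destruct (is_improper_limit (fun x => -1 * (x ^ s * polylog_exp t (- (q * x)) * w x))
    (fun N x => sum_n (fun n => (-1) ^ n / INR (S n) ^ t * (x ^ s * exp (- (q * INR (S n) * x)) * w x)) N)
    (fun N x => x ^ s * exp (- ((q * INR (S (S N))) * x)))
    (fun N => sum_n (fun n => (-1) ^ n / INR (S n) ^ t * v n) N)
    (fun N => INR (fact s) / (q * INR (S (S N))) ^ S s)) as [l [Hl Hi]].
  - intros M _. apply ex_RInt_cont. intros x.
    apply (continuous_scal_r (-1) (fun x => x ^ s * polylog_exp t (- (q * x)) * w x)).
    apply (continuous_mult (fun x => x ^ s * polylog_exp t (- (q * x))) w); [| apply Cw].
    apply (continuous_mult (fun x => x ^ s) (fun x => polylog_exp t (- (q * x)))).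
    apply (ex_derive_continuous (fun x => x ^ s)). auto_derive. easy.
    apply (continuous_comp (fun x => - (q * x)) (polylog_exp t)).
    apply (ex_derive_continuous (fun x => - (q * x))). auto_derive. easy.
    apply continuous_polylog_exp.
  - intros N. apply (is_improper_sum_n (fun n x => (-1) ^ n / INR (S n) ^ t * (x ^ s * exp (- (q * INR (S n) * x)) * w x))).
    intros k. now apply is_improper_scal.
  - intros N. apply is_improper_pow_exp. apply Rmult_lt_0_compat. easy. apply INR_S_pos.
  - intros N x Hx. destruct (Bw x Hx) as [W0 W1].
    assert (P : 0 < x ^ s) by now apply pow_lt.
    assert (Hqx : 0 < q * x) by now apply Rmult_lt_0_compat.
    rewrite (sum_n_ext _ (fun n => mult (x ^ s * w x)
               ((-1) ^ n * (exp (- (INR (S n) * (q * x))) / INR (S n) ^ t)))).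
    2:{ intros n. replace (q * INR (S n) * x) with (INR (S n) * (q * x)) by ring.
        change (@eq R ((-1) ^ n / INR (S n) ^ t * (x ^ s * exp (- (INR (S n) * (q * x))) * w x))
          (x ^ s * w x * ((-1) ^ n * (exp (- (INR (S n) * (q * x))) / INR (S n) ^ t)))).
        unfold Rdiv. ring. }
    rewrite (sum_n_mult_l (x ^ s * w x)). change (mult ?a ?b) with (a * b).
    replace (-1 * (x ^ s * polylog_exp t (- (q * x)) * w x)) with
      (x ^ s * w x * - polylog_exp t (- (q * x))) by ring.
    rewrite <- Rmult_minus_distr_l, Rabs_mult, (Rabs_pos_eq (x ^ s * w x)).
    2: apply Rmult_le_pos; lra.
    rewrite (Rmult_assoc (x ^ s)). apply Rmult_le_compat_l. lra.
    apply Rle_trans with (1 * (exp (- (INR (S (S N)) * (q * x))) / INR (S (S N)) ^ t)).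
    + apply Rmult_le_compat; try lra. apply Rabs_pos. now apply polylog_exp_remainder.
    + rewrite Rmult_1_l.
      replace (q * INR (S (S N)) * x) with (INR (S (S N)) * (q * x)) by ring.
      unfold Rdiv. rewrite <- (Rmult_1_r (exp _)) at 2. apply Rmult_le_compat_l.
      apply Rlt_le, exp_pos. rewrite <- Rinv_1. apply Rinv_le_contravar. lra.
      apply pow_R1_Rle. rewrite S_INR. generalize (INR_S_pos N). lra.
  - apply is_lim_seq_ext with (fun N => INR (fact s) / (0 + q * INR (S (S N))) ^ S s).
    { intros n. now rewrite Rplus_0_l. }
    apply is_lim_seq_fact_div; lra.
  - exists (-1 * l). split.
    + apply (is_improper_scal (-1)) in Hi. revert Hi. apply is_improper_ext.
      intros x _. ring.
    + replace (- (-1 * l)) with l by ring. apply is_series_ext with (2 := Hl).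
      intros n. change (@eq R ((-1) ^ n / INR (S n) ^ t * v n) ((-1) ^ n * (v n / INR (S n) ^ t))).
      unfold Rdiv. ring.
Qed.

(** Weight 1: the factors [1 / (q n)^(s+1)] and [1 / n^t] merge into a single eta series. This is
    the source of the isolated eta term. *)
Lemma is_improper_polylog_exp_pow (s t : nat) (q : R) : 0 < q ->
  is_improper (fun x => x ^ s * polylog_exp t (- (q * x)))
    (- (INR (fact s) / q ^ S s * eta (S (s + t)))).
Proof.
  intros Hq.
  destruct (is_improper_polylog_exp s t q (fun _ => 1)
    (fun n => INR (fact s) / (q * INR (S n)) ^ S s) Hq) as [l [Hl Hs]].
  - intros x. apply continuous_const.
  - intros. lra.
  - intros n. apply is_improper_ext with (fun x => x ^ s * exp (- (q * INR (S n) * x))).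
    intros; ring. apply is_improper_pow_exp. apply Rmult_lt_0_compat. easy. apply INR_S_pos.
  - replace (- (INR (fact s) / q ^ S s * eta (S (s + t)))) with l.
    { revert Hl. apply is_improper_ext. intros; ring. }
    apply Ropp_eq_reg. rewrite Ropp_involutive.
    rewrite <- (is_series_unique _ _ Hs). apply is_series_unique.
    generalize (is_series_scal (INR (fact s) / q ^ S s) _ _ (is_series_eta (s + t))).
    apply is_series_ext. intros n.
    change (INR (fact s) / q ^ S s * ((-1) ^ n * / INR (S n) ^ S (s + t))
      = (-1) ^ n * (INR (fact s) / (q * INR (S n)) ^ S s / INR (S n) ^ t)).
    rewrite Rpow_mult_distr. replace (S (s + t)) with (S s + t)%nat by lia.
    rewrite pow_add. field. repeat split.
    all: try apply INR_S_pow_neq_0. apply pow_nonzero. lra.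
Qed.

(** The double series is kept in iterated form, with the sum over [j] performed first inside
    [alt_hurwitz], so no rearrangement is required. *)
Lemma is_improper_polylog_exp_fermi (s t : nat) (q : R) : 0 < q ->
  exists J, is_improper (fun x => x ^ s * polylog_exp t (- (q * x)) * / (1 + exp x)) J /\
    is_series (fun n => (-1) ^ n * (alt_hurwitz (S s) (q * INR (S n)) / INR (S n) ^ t))
      (- J / INR (fact s)).
Proof.
  intros Hq.
  destruct (is_improper_polylog_exp s t q (fun x => / (1 + exp x))
    (fun n => INR (fact s) * alt_hurwitz (S s) (q * INR (S n))) Hq) as [J [HJ Hs]].
  - intros x. apply (ex_derive_continuous (fun x => / (1 + exp x))).
    auto_derive. generalize (exp_pos x). lra.
  - intros x _. generalize (exp_pos x). intros H. split.
    apply Rlt_le, Rinv_0_lt_compat. lra.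
    rewrite <- Rinv_1. apply Rinv_le_contravar; lra.
  - intros n. apply is_improper_fermi. apply Rlt_le, Rmult_lt_0_compat. easy. apply INR_S_pos.
  - exists J. split. easy. apply (is_series_lim_scal _ _ _ (INR_fact_neq_0 s)).
    apply is_series_ext with (2 := Hs). intros n.
    change (@eq R ((-1) ^ n * (INR (fact s) * alt_hurwitz (S s) (q * INR (S n)) / INR (S n) ^ t))
      (INR (fact s) * ((-1) ^ n * (alt_hurwitz (S s) (q * INR (S n)) / INR (S n) ^ t)))).
    unfold Rdiv. ring.
Qed.

(** * The Gamma function *)

(** The partial integrals increase and are bounded by [B]; their supremum is the limit. *)
Lemma is_improper_dominated (f h : R -> R) (B : R) :
  (forall M, 0 <= M -> ex_RInt f 0 M) -> (forall x, 0 < x -> 0 <= f x <= h x) ->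
  is_improper h B -> exists l, is_improper f l.
Proof.
  intros Ef Hf Hh.
  assert (Mono : forall M K, 0 <= M <= K -> RInt f 0 M <= RInt f 0 K).
  { intros M K HMK.
    assert (E : ex_RInt f M K).
    { apply (ex_RInt_Chasles_2 f 0). lra. apply Ef; lra. }
    rewrite <- (RInt_Chasles f 0 M K); [| apply Ef; lra | easy].
    assert (0 <= RInt f M K); [| unfold plus; simpl; lra].
    apply RInt_ge_0. lra. easy. intros x Hx. apply Hf. lra. }
  destruct (completeness (fun y => exists M, 0 <= M /\ y = RInt f 0 M)) as [l [Hub Hlub]].
  - exists B. intros y [M [HM ->]]. apply Rle_trans with (RInt h 0 M).
    + apply RInt_le. easy. now apply Ef. now apply Hh. intros x Hx. apply Hf. lra.
    + apply is_improper_partial_le; try easy. intros x Hx. generalize (Hf x Hx). lra.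
  - exists (RInt f 0 0). exists 0. split. lra. easy.
  - exists l. split. easy. apply is_lim_spec. intros eps. simpl.
    assert (Ex : exists M, 0 <= M /\ l - eps < RInt f 0 M).
    { apply NNPP. intros N. assert (l <= l - eps); [| generalize (cond_pos eps); lra].
      apply Hlub. intros y [M [HM ->]]. apply Rnot_lt_le. intros L. apply N. now exists M. }
    destruct Ex as [M [HM L]]. exists M. intros K HK.
    assert (RInt f 0 M <= RInt f 0 K) by (apply Mono; lra).
    assert (RInt f 0 K <= l) by (apply Hub; exists K; split; [lra | easy]).
    apply Rabs_def1; generalize (cond_pos eps); lra.
Qed.

Lemma is_improper_le (f h : R -> R) (l m : R) :
  (forall x, 0 < x -> f x <= h x) -> is_improper f l -> is_improper h m -> l <= m.
Proof.
  intros H [Ef Lf] [Eh Lh].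
  apply (is_lim_le_loc (RInt f 0) (RInt h 0) p_infty l m); try easy.
  exists 0. intros M HM. apply RInt_le; try (apply Ef || apply Eh); try lra.
  intros x Hx. apply H. lra.
Qed.

(** The definition of [Gamma] approaches 0 from the right. Since [g] is continuous at 0, its
    integral over [[0, a]] is below [eps / 2] for small [a], so the lower bound may be moved to
    0. *)
Lemma is_RInt_gen_improper (f g : R -> R) (l : R) :
  (forall x, continuous g x) -> (forall x, 0 < x -> f x = g x) -> is_improper g l ->
  is_RInt_gen f (at_right 0) (Rbar_locally p_infty) l.
Proof.
  intros Cg E [_ L] P [eps HP].
  apply is_lim_spec in L. destruct (L (pos_div_2 eps)) as [M0 HM0].
  assert (C0 : continuous (RInt g 0) 0).
  { apply (ex_derive_continuous (RInt g 0)). exists (g 0). apply (is_derive_RInt g (RInt g 0) 0 0).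
    - exists eps. intros y _. apply (@RInt_correct R_CompleteNormedModule). now apply ex_RInt_cont.
    - apply Cg. }
  specialize (C0 _ (locally_ball _ (pos_div_2 eps))). destruct C0 as [d Hd].
  exists (fun a => 0 < a < d) (fun M => Rmax d M0 < M).
  - exists d. intros y Hy Hy0. split. easy.
    unfold ball in Hy; simpl in Hy; unfold AbsRing_ball, abs, minus, plus, opp in Hy.
    simpl in Hy. rewrite Rabs_pos_eq in Hy; lra.
  - exists (Rmax d M0). easy.
  - intros a M [Ha0 Ha] HM. simpl.
    assert (HM1 : d < M) by (eapply Rle_lt_trans; [apply Rmax_l | apply HM]).
    assert (HM2 : M0 < M) by (eapply Rle_lt_trans; [apply Rmax_r | apply HM]).
    exists (RInt g a M). split.
    + apply is_RInt_ext with g.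
      * intros x Hx. symmetry. apply E. rewrite Rmin_left in Hx; lra.
      * apply (@RInt_correct R_CompleteNormedModule). now apply ex_RInt_cont.
    + apply HP.
      assert (Ch : RInt g 0 a + RInt g a M = RInt g 0 M).
      { apply (RInt_Chasles g); now apply ex_RInt_cont. }
      specialize (HM0 M HM2). simpl in HM0.
      assert (Hs : ball 0 d a).
      { unfold ball; simpl; unfold AbsRing_ball, abs, minus, plus, opp; simpl.
        rewrite Rabs_pos_eq; lra. }
      specialize (Hd a Hs). rewrite RInt_point in Hd.
      unfold ball in *; simpl in *; unfold AbsRing_ball, abs, minus, plus, opp, zero in *.
      simpl in *. apply Rabs_def2 in Hd, HM0. apply Rabs_def1; lra.
Qed.

(** The integrand of [Gamma (s + 1)]. [Rpower u s] takes the default value 1 for [u <= 0]; the value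
    0 put there instead gives a function continuous on the whole line when [s > 0]. *)
Definition gamma_density (s u : R) : R :=
  if Rlt_dec 0 u then Rpower u s * exp (- u) else 0.

Lemma gamma_density_pos (s u : R) : 0 < u -> gamma_density s u = Rpower u s * exp (- u).
Proof. intros H. unfold gamma_density. now destruct (Rlt_dec 0 u). Qed.

Lemma gamma_density_nonpos (s u : R) : u <= 0 -> gamma_density s u = 0.
Proof. intros H. unfold gamma_density. destruct (Rlt_dec 0 u). lra. easy. Qed.

Lemma is_derive_gamma_density (s u : R) : 0 < u ->
  is_derive (gamma_density s) u (s * gamma_density (s - 1) u - gamma_density s u).
Proof.
  intros Hu.
  apply is_derive_ext_loc with (fun u => exp (s * ln u) * exp (- u)).
  { generalize (locally_gt u 0 Hu). apply filter_imp. intros y Hy.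
    now rewrite gamma_density_pos. }
  rewrite !gamma_density_pos by easy. auto_derive. easy.
  replace (s - 1) with (s + - (1)) by ring. rewrite Rpower_plus, Rpower_Ropp, Rpower_1 by easy.
  unfold Rpower. field. lra.
Qed.

Lemma continuous_gamma_density (s u : R) : 0 < s -> continuous (gamma_density s) u.
Proof.
  intros Hs. destruct (Rtotal_order u 0) as [L | [-> | L]].
  - apply continuous_ext_loc with (fun _ => 0).
    + generalize (locally_lt u 0 L). apply filter_imp. intros y Hy.
      rewrite gamma_density_nonpos; lra.
    + apply continuous_const.
  - intros P. rewrite gamma_density_nonpos by lra. intros [eps HP].
    (* The radius is [eps ^ (1/s)], so that [y ^ s < eps]; the exponential factor is below 1. *)
    exists (mkposreal _ (exp_pos (ln eps / s))). intros y Hy. apply HP.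
    unfold ball in *; simpl in *; unfold AbsRing_ball, abs, minus, plus, opp in *.
    simpl in *. rewrite Ropp_0, Rplus_0_r in *.
    destruct (Rlt_or_le 0 y) as [Py | Ny].
    2:{ rewrite gamma_density_nonpos, Rabs_R0 by easy. apply cond_pos. }
    rewrite gamma_density_pos by easy. rewrite Rabs_pos_eq in Hy by lra.
    assert (E1 : exp (- y) < 1) by (rewrite <- exp_0; apply exp_increasing; lra).
    assert (E2 : Rpower y s < eps).
    { unfold Rpower. rewrite <- (exp_ln eps) by apply cond_pos. apply exp_increasing.
      apply Rmult_lt_reg_r with (/ s). now apply Rinv_0_lt_compat.
      replace (s * ln y * / s) with (ln y) by (field; lra).
      rewrite <- (ln_exp (ln eps * / s)). apply ln_increasing; easy. }
    assert (0 < Rpower y s) by apply exp_pos. generalize (exp_pos (- y)). intros.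
    rewrite Rabs_pos_eq by (apply Rmult_le_pos; lra).
    apply Rlt_trans with (2 := E2). rewrite <- (Rmult_1_r (Rpower y s)) at 2.
    now apply Rmult_lt_compat_l.
  - apply (ex_derive_continuous (gamma_density s)). eexists. now apply is_derive_gamma_density.
Qed.

Lemma gamma_density_mult (s u : R) : gamma_density s u = u * gamma_density (s - 1) u.
Proof.
  destruct (Rlt_or_le 0 u).
  - rewrite !gamma_density_pos by easy. replace s with (1 + (s - 1)) at 1 by ring.
    rewrite Rpower_plus, Rpower_1 by easy. ring.
  - rewrite !gamma_density_nonpos by easy. ring.
Qed.

(** At 0 the difference quotient is [gamma_density (s - 1) h], which tends to 0 because [s - 1 > 0].
    Including 0 permits the fundamental theorem on [[0, M]]. *)
Lemma is_derive_gamma_density_all (s u : R) : 1 < s ->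
  is_derive (gamma_density s) u (s * gamma_density (s - 1) u - gamma_density s u).
Proof.
  intros Hs. destruct (Rtotal_order u 0) as [L | [-> | L]].
  - apply is_derive_ext_loc with (fun _ => 0).
    + generalize (locally_lt u 0 L). apply filter_imp. intros y Hy.
      rewrite gamma_density_nonpos; lra.
    + rewrite !gamma_density_nonpos by lra. auto_derive. easy. ring.
  - rewrite !gamma_density_nonpos by lra. apply is_derive_Reals. intros eps Heps.
    assert (C : continuous (gamma_density (s - 1)) 0) by (apply continuous_gamma_density; lra).
    specialize (C _ (locally_ball _ (mkposreal eps Heps))). destruct C as [d Hd].
    exists d. intros h Hh0 Hh. rewrite Rplus_0_l, (gamma_density_mult s h).
    rewrite (gamma_density_nonpos s 0) by lra.
    specialize (Hd h). rewrite (gamma_density_nonpos _ 0) in Hd by lra.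
    unfold ball in Hd; simpl in Hd; unfold AbsRing_ball, abs, minus, plus, opp in Hd.
    simpl in Hd. rewrite Ropp_0, !Rplus_0_r in Hd.
    replace ((h * gamma_density (s - 1) h - 0) / h - (s * 0 - 0))
      with (gamma_density (s - 1) h) by (field; easy).
    now apply Hd.
  - now apply is_derive_gamma_density.
Qed.

Lemma gamma_density_nonneg (s u : R) : 0 <= gamma_density s u.
Proof.
  unfold gamma_density. destruct (Rlt_dec 0 u); [| lra].
  apply Rlt_le, Rmult_lt_0_compat; apply exp_pos.
Qed.

Lemma Rpower_le_pow (s u : R) (N : nat) : s <= INR N -> 1 <= u -> Rpower u s <= u ^ N.
Proof.
  intros Hs Hu. rewrite <- Rpower_pow by lra.
  destruct (Req_dec u 1) as [-> | Hne].
  - unfold Rpower. rewrite ln_1, !Rmult_0_r. lra.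
  - apply Rle_Rpower; lra.
Qed.

Lemma exists_INR_ge (s : R) : exists N : nat, s <= INR N.
Proof. destruct (INR_unbounded s) as [N HN]. exists N. lra. Qed.

Lemma is_improper_gamma_density (s : R) : 0 < s ->
  is_improper (gamma_density s) (Gamma (s + 1)).
Proof.
  intros Hs. destruct (exists_INR_ge s) as [N HN].
  assert (Cg : forall u, continuous (gamma_density s) u)
    by (intros; now apply continuous_gamma_density).
  (* [u ^ s] is at most 1 for [u < 1] and at most [u ^ N] otherwise, so [1 + u ^ N] majorises it. *)
  destruct (is_improper_dominated (gamma_density s)
    (fun u => u ^ 0 * exp (- (1 * u)) + u ^ N * exp (- (1 * u)))
    (INR (fact 0) / 1 ^ 1 + INR (fact N) / 1 ^ S N)) as [l Hl].
  - intros M _. now apply ex_RInt_cont.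
  - intros u Hu. split. apply gamma_density_nonneg. rewrite gamma_density_pos by easy.
    rewrite <- Rmult_plus_distr_r, Rmult_1_l. apply Rmult_le_compat_r.
    apply Rlt_le, exp_pos. assert (0 < u ^ N) by now apply pow_lt.
    destruct (Rle_or_lt 1 u).
    + generalize (Rpower_le_pow s u N HN H0). simpl. lra.
    + assert (Rpower u s <= 1); [| simpl; lra].
      unfold Rpower. rewrite <- exp_0. apply exp_le.
      assert (ln u < 0) by (rewrite <- ln_1; now apply ln_increasing).
      generalize (Rmult_lt_0_compat s (- ln u)). lra.
  - apply is_improper_plus; apply is_improper_pow_exp; lra.
  - replace (Gamma (s + 1)) with l. easy. symmetry. apply is_RInt_gen_unique.
    apply is_RInt_gen_improper with (gamma_density s); try easy.
    intros x Hx. rewrite gamma_density_pos by easy. do 2 f_equal. ring.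
Qed.

Lemma Gamma_pos (s : R) : 1 < s -> 0 < Gamma s.
Proof.
  intros Hs. assert (H : is_improper (gamma_density (s - 1)) (Gamma (s - 1 + 1)))
    by (apply is_improper_gamma_density; lra).
  replace (s - 1 + 1) with s in H by ring.
  apply Rlt_le_trans with (RInt (gamma_density (s - 1)) 0 1).
  - apply RInt_gt_0. lra.
    + intros x Hx. rewrite gamma_density_pos by easy.
      apply Rmult_lt_0_compat; apply exp_pos.
    + intros x _. apply continuous_gamma_density. lra.
  - apply is_improper_partial_le with (2 := H). intros. apply gamma_density_nonneg. lra.
Qed.

Lemma is_lim_gamma_density (s : R) : is_lim (gamma_density s) p_infty 0.
Proof.
  destruct (exists_INR_ge s) as [N HN].
  apply (is_lim_le_le_loc (fun _ => 0) (fun x => x ^ N * exp (- (1 * x)))).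
  - exists 1. intros x Hx. split. apply gamma_density_nonneg.
    rewrite gamma_density_pos, Rmult_1_l by lra. apply Rmult_le_compat_r.
    apply Rlt_le, exp_pos. apply Rpower_le_pow; lra.
  - apply is_lim_const.
  - apply is_lim_pow_exp. lra.
Qed.

(** The difference of the two integrands is the derivative of [gamma_density s], which vanishes at 0
    and at infinity. *)
Lemma Gamma_succ (s : R) : 1 < s -> Gamma (s + 1) = s * Gamma s.
Proof.
  intros Hs.
  assert (H1 : is_improper (gamma_density s) (Gamma (s + 1)))
    by (apply is_improper_gamma_density; lra).
  assert (H2 : is_improper (gamma_density (s - 1)) (Gamma (s - 1 + 1)))
    by (apply is_improper_gamma_density; lra).
  replace (s - 1 + 1) with s in H2 by ring.
  assert (H3 := is_improper_plus _ _ _ _ (is_improper_scal s _ _ H2) (is_improper_scal (-1) _ _ H1)).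
  enough (s * Gamma s + -1 * Gamma (s + 1) = 0) by lra.
  destruct H3 as [_ H3].
  assert (L := is_lim_gamma_density s). apply is_lim_unique in L.
  enough (E : forall M, RInt (fun x => s * gamma_density (s - 1) x + -1 * gamma_density s x) 0 M
                 = gamma_density s M).
  { apply (is_lim_ext _ _ _ _ E), is_lim_unique in H3. rewrite L in H3.
    injection H3. easy. }
  intros M. apply is_RInt_unique.
  replace (gamma_density s M) with (minus (gamma_density s M) (gamma_density s 0)).
  2:{ rewrite (gamma_density_nonpos s 0) by lra. apply Rminus_0_r. }
  apply (is_RInt_derive (gamma_density s)).
  - intros x _. replace (s * gamma_density (s - 1) x + -1 * gamma_density s x)
      with (s * gamma_density (s - 1) x - gamma_density s x) by ring.
    now apply is_derive_gamma_density_all.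
  - intros x _.
    apply (continuous_plus (fun x => s * gamma_density (s - 1) x) (fun x => -1 * gamma_density s x)).
    + apply (continuous_scal_r s (gamma_density (s - 1))), continuous_gamma_density. lra.
    + apply (continuous_scal_r (-1) (gamma_density s)), continuous_gamma_density. lra.
Qed.

(* Tangent lines of the exponential at [h * ln x], evaluated at [ln x] and [0]. *)
Lemma Rpower_le_tangent (x h : R) : 0 < x -> 0 <= h <= 1 -> Rpower x h <= 1 + h * (x - 1).
Proof.
  intros Hx Hh. unfold Rpower. set (y := ln x).
  replace x with (exp y) by now apply exp_ln.
  assert (T : forall z, exp (h * y) * (1 + (z - h * y)) <= exp z).
  { intros z. replace (exp z) with (exp (h * y) * exp (z - h * y))
      by (rewrite <- exp_plus; f_equal; ring).
    apply Rmult_le_compat_l. apply Rlt_le, exp_pos. apply exp_ineq1_le. }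
  generalize (Rmult_le_compat_l h _ _ (proj1 Hh) (T y)).
  generalize (T 0). rewrite exp_0. intros T0.
  assert (H1 : 0 <= 1 - h) by lra.
  generalize (Rmult_le_compat_l (1 - h) _ _ H1 T0). nra.
Qed.

(** The preceding inequality at the point [x ^ k] with exponent [1 / k]. *)
Lemma Rpower_ge_tangent (x k : R) : 0 < x -> 1 <= k -> 1 + k * (x - 1) <= Rpower x k.
Proof.
  intros Hx Hk. assert (0 < / k <= 1).
  { split. apply Rinv_0_lt_compat. lra. rewrite <- Rinv_1. apply Rinv_le_contravar; lra. }
  generalize (Rpower_le_tangent (Rpower x k) (/ k) (exp_pos _)). intros T.
  rewrite Rpower_mult, Rinv_r, Rpower_1 in T by lra.
  assert (k * x <= k * (1 + / k * (Rpower x k - 1))).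
  { apply Rmult_le_compat_l. lra. apply T. lra. }
  replace (k * (1 + / k * (Rpower x k - 1))) with (k + Rpower x k - 1) in H0 by (field; lra).
  lra.
Qed.

Lemma Rpower_div_mult (u c h : R) : 0 < u -> 0 < c ->
  Rpower u h = Rpower c h * Rpower (u / c) h.
Proof.
  intros Hu Hc. rewrite Rpower_mult_distr by (try apply Rdiv_lt_0_compat; easy).
  f_equal. field. lra.
Qed.

Lemma gamma_density_plus (s h u : R) : 0 < u ->
  gamma_density (s + h) u = Rpower u h * gamma_density s u.
Proof.
  intros Hu. rewrite !gamma_density_pos, Rpower_plus by easy. ring.
Qed.

(* Jensen's inequality for [u ^ h] against the densities of [Gamma s]. *)
Lemma Gamma_upper (s h : R) : 1 < s -> 0 <= h <= 1 ->
  Gamma (s + h) <= Rpower s h * Gamma s.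
Proof.
  intros Hs Hh.
  assert (H0 : is_improper (gamma_density (s - 1)) (Gamma (s - 1 + 1)))
    by (apply is_improper_gamma_density; lra).
  assert (H1 : is_improper (gamma_density s) (Gamma (s + 1)))
    by (apply is_improper_gamma_density; lra).
  assert (H2 : is_improper (gamma_density (s - 1 + h)) (Gamma (s - 1 + h + 1)))
    by (apply is_improper_gamma_density; lra).
  replace (s - 1 + 1) with s in H0 by ring.
  replace (s - 1 + h + 1) with (s + h) in H2 by ring.
  assert (H3 := is_improper_scal (Rpower s h) _ _ (is_improper_plus _ _ _ _
    (is_improper_scal (1 - h) _ _ H0) (is_improper_scal (h / s) _ _ H1))).
  rewrite Gamma_succ in H3 by easy.
  replace ((1 - h) * Gamma s + h / s * (s * Gamma s)) with (Gamma s) in H3 by (field; lra).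
  apply (is_improper_le _ _ _ _) with (2 := H2) (3 := H3).
  intros u Hu. rewrite gamma_density_plus, (gamma_density_mult s) by easy.
  rewrite (Rpower_div_mult u s h) by lra. rewrite Rmult_assoc.
  apply Rmult_le_compat_l. apply Rlt_le, exp_pos.
  replace ((1 - h) * gamma_density (s - 1) u + h / s * (u * gamma_density (s - 1) u)) with
    ((1 + h * (u / s - 1)) * gamma_density (s - 1) u) by (field; lra).
  apply Rmult_le_compat_r. apply gamma_density_nonneg.
  apply Rpower_le_tangent. apply Rdiv_lt_0_compat; lra. easy.
Qed.

(** Jensen's inequality in the convex range: under the density of [Gamma s] the mean of [u] is [s],
    so the exponent [1 + h >= 1] gives [Gamma (s+1+h) >= s^(1+h) Gamma s], and one factor [s] is
    absorbed by the functional equation. *)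
Lemma Gamma_lower (s h : R) : 1 < s -> 0 <= h ->
  Rpower s h * Gamma (s + 1) <= Gamma (s + 1 + h).
Proof.
  intros Hs Hh.
  assert (H0 : is_improper (gamma_density (s - 1)) (Gamma (s - 1 + 1)))
    by (apply is_improper_gamma_density; lra).
  assert (H1 : is_improper (gamma_density s) (Gamma (s + 1)))
    by (apply is_improper_gamma_density; lra).
  assert (H2 : is_improper (gamma_density (s - 1 + (1 + h))) (Gamma (s - 1 + (1 + h) + 1)))
    by (apply is_improper_gamma_density; lra).
  replace (s - 1 + 1) with s in H0 by ring.
  replace (s - 1 + (1 + h) + 1) with (s + 1 + h) in H2 by ring.
  assert (H3 := is_improper_scal (Rpower s (1 + h)) _ _ (is_improper_plus _ _ _ _
    (is_improper_scal (- h) _ _ H0) (is_improper_scal ((1 + h) / s) _ _ H1))).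
  rewrite Gamma_succ in H3 |- * by easy.
  replace (Rpower s (1 + h) * (- h * Gamma s + (1 + h) / s * (s * Gamma s)))
    with (Rpower s h * (s * Gamma s)) in H3.
  2:{ rewrite Rpower_plus, Rpower_1 by lra. field. lra. }
  apply (is_improper_le _ _ _ _) with (2 := H3) (3 := H2).
  intros u Hu. rewrite gamma_density_plus, (gamma_density_mult s) by easy.
  rewrite (Rpower_div_mult u s (1 + h)) by lra. rewrite Rmult_assoc.
  apply Rmult_le_compat_l. apply Rlt_le, exp_pos.
  replace (- h * gamma_density (s - 1) u + (1 + h) / s * (u * gamma_density (s - 1) u)) with
    ((1 + (1 + h) * (u / s - 1)) * gamma_density (s - 1) u) by (field; lra).
  apply Rmult_le_compat_r. apply gamma_density_nonneg.
  apply Rpower_ge_tangent. apply Rdiv_lt_0_compat; lra. lra.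
Qed.

(** * The digamma function and extended harmonic numbers *)

(* Convexity with subgradient [G].  If [G] is continuous, this forces [F' = G], which replaces
   differentiation under the integral sign and termwise differentiation.  Steps are at most 1
   because [Gamma_upper] holds for exponents in [[0, 1]] only. *)
Definition convex_sandwich (F G : R -> R) : Prop :=
  forall x y, 1 < x -> x < y <= x + 1 ->
    (y - x) * G x <= F y - F x <= (y - x) * G y.

(** The sandwich makes [G] monotone, hence bounded near [x] by its values at [x - d] and [x + d], so
    [F] is Lipschitz there. Applied one order higher, this supplies the continuity of [G] that
    differentiability asks for. *)
Lemma convex_sandwich_continuous (F G : R -> R) (x : R) :
  convex_sandwich F G -> 1 < x -> continuous F x.
Proof.
  intros S Hx.
  assert (Gm : forall y z, 1 < y -> y < z <= y + 1 -> G y <= G z).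
  { intros y z Hy Hz. generalize (S y z Hy Hz). intros [H1 H2].
    apply Rmult_le_reg_l with (z - y); lra. }
  (* The first bound keeps all steps within length 1, the second keeps [x - d] above 1. *)
  set (d := Rmin (1/2) ((x - 1) / 2)).
  assert (Hd : 0 < d <= 1/2 /\ d <= (x - 1) / 2).
  { unfold d. split. split. apply Rmin_pos; lra. apply Rmin_l. apply Rmin_r. }
  set (K := Rabs (G (x - d)) + Rabs (G (x + d)) + 1).
  assert (HG : forall y, x - d < y < x + d -> Rabs (G y) <= K).
  { intros y Hy. generalize (Gm (x - d) y) (Gm y (x + d)). intros A1 A2.
    assert (B1 : G (x - d) <= G y) by (apply A1; lra).
    assert (B2 : G y <= G (x + d)) by (apply A2; lra).
    unfold K. generalize (Rabs_pos (G (x - d))) (Rabs_pos (G (x + d)))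
      (Rle_abs (G (x + d))) (Rle_abs (- G (x - d))). rewrite Rabs_Ropp.
    intros. apply Rabs_le. lra. }
  assert (HK : 0 < K).
  { unfold K. generalize (Rabs_pos (G (x - d))) (Rabs_pos (G (x + d))). lra. }
  assert (Lip : forall y, Rabs (y - x) < d -> Rabs (F y - F x) <= K * Rabs (y - x)).
  { intros y Hy. apply Rabs_def2 in Hy.
    assert (Gy : Rabs (G y) <= K) by (apply HG; lra).
    assert (Gx : Rabs (G x) <= K) by (apply HG; lra).
    apply Rabs_def2_le in Gy, Gx.
    destruct (Rtotal_order x y) as [L | [-> | L]].
    - generalize (S x y Hx). intros T. rewrite (Rabs_pos_eq (y - x)) by lra.
      apply Rabs_le. split; nra.
    - rewrite !Rminus_diag, Rabs_R0. lra.
    - generalize (S y x). intros T. rewrite (Rabs_left1 (y - x)) by lra.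
      apply Rabs_le. split; nra. }
  intros P [eps HP].
  assert (Hr : 0 < Rmin d (eps / K)).
  { apply Rmin_pos. lra. apply Rdiv_lt_0_compat. apply cond_pos. easy. }
  exists (mkposreal _ Hr). intros y Hy. apply HP.
  change (Rabs (y - x) < Rmin d (eps / K)) in Hy. change (Rabs (F y - F x) < eps).
  eapply Rle_lt_trans. apply Lip. eapply Rlt_le_trans. apply Hy. apply Rmin_l.
  apply Rmult_lt_reg_l with (/ K). now apply Rinv_0_lt_compat.
  rewrite <- Rmult_assoc, Rinv_l, Rmult_1_l, Rmult_comm by lra.
  eapply Rlt_le_trans. apply Hy. apply Rmin_r.
Qed.

(** For small [h] the difference quotient lies between [G x] and [G (x + h)]. *)
Lemma convex_sandwich_derive (F G : R -> R) (x : R) :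
  convex_sandwich F G -> 1 < x -> continuous G x -> is_derive F x (G x).
Proof.
  intros S Hx C. apply is_derive_Reals. intros eps Heps.
  specialize (C _ (locally_ball _ (mkposreal eps Heps))). destruct C as [d Hd].
  assert (Hr : 0 < Rmin d (Rmin 1 (x - 1))).
  { apply Rmin_pos. apply cond_pos. apply Rmin_pos; lra. }
  exists (mkposreal _ Hr). intros h Hh0 Hh. simpl in Hh.
  assert (H1 : Rabs h < d) by (eapply Rlt_le_trans; [apply Hh | apply Rmin_l]).
  assert (H2 : Rabs h < Rmin 1 (x - 1)) by (eapply Rlt_le_trans; [apply Hh | apply Rmin_r]).
  assert (H3 : Rabs h < 1) by (eapply Rlt_le_trans; [apply H2 | apply Rmin_l]).
  assert (H4 : Rabs h < x - 1) by (eapply Rlt_le_trans; [apply H2 | apply Rmin_r]).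
  assert (D : Rabs (G (x + h) - G x) < eps).
  { apply (Hd (x + h)). change (Rabs (x + h - x) < d). now replace (x + h - x) with h by ring. }
  apply Rabs_def2 in H3, H4, D.
  set (q := (F (x + h) - F x) / h).
  assert (E : F (x + h) - F x = h * q) by (unfold q; field; easy).
  destruct (Rtotal_order 0 h) as [L | [? | L]]; [| lra |].
  - destruct (S x (x + h)) as [A B]. easy. lra.
    rewrite E in A, B. replace (x + h - x) with h in A, B by ring.
    apply Rmult_le_reg_l in A, B; try easy. apply Rabs_def1; lra.
  - destruct (S (x + h) x) as [A B]. lra. lra.
    replace (F x - F (x + h)) with (- h * q) in A, B by lra.
    replace (x - (x + h)) with (- h) in A, B by ring.
    apply Rmult_le_reg_l in A, B; try lra. apply Rabs_def1; lra.
Qed.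

Lemma is_series_le (a b : nat -> R) (la lb : R) :
  (forall n, a n <= b n) -> is_series a la -> is_series b lb -> la <= lb.
Proof.
  intros H Ha Hb.
  apply (is_lim_seq_le (sum_n a) (sum_n b) la lb); [| apply Ha | apply Hb].
  intros n. apply sum_n_m_le. intros k. apply H.
Qed.

Lemma is_series_minus_R (a b : nat -> R) (la lb : R) :
  is_series a la -> is_series b lb -> is_series (fun n => a n - b n) (la - lb).
Proof. intros Ha Hb. exact (is_series_minus a b la lb Ha Hb). Qed.

Lemma is_series_scal_R (c : R) (a : nat -> R) (l : R) :
  is_series a l -> is_series (fun n => c * a n) (c * l).
Proof. exact (is_series_scal c a l). Qed.

(** Tangent line of the convex function [y ^ (-m)] at [x]. With [w = y / x], [w^(-m) = exp (- m ln
    w) >= 1 - m ln w >= 1 - m (w - 1)]. *)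
Lemma inv_pow_tangent (m : nat) (x y : R) : 0 < x -> 0 < y ->
  (y - x) * (- INR m * / x ^ S m) <= / y ^ m - / x ^ m.
Proof.
  intros Hx Hy.
  assert (Px : 0 < / x ^ m) by now apply Rinv_0_lt_compat, pow_lt.
  assert (Hw : 0 < y / x) by now apply Rdiv_lt_0_compat.
  assert (L : ln (y / x) <= y / x - 1).
  { generalize (exp_ineq1_le (ln (y / x))). rewrite exp_ln by easy. lra. }
  assert (T : 1 - INR m * (y / x - 1) <= / (y / x) ^ m).
  { replace (/ (y / x) ^ m) with (exp (- (INR m * ln (y / x)))).
    2:{ rewrite exp_Ropp, exp_INR_mult, exp_ln; easy. }
    eapply Rle_trans; [| apply exp_ineq1_le].
    generalize (Rmult_le_compat_l (INR m) _ _ (pos_INR m) L). lra. }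
  apply (Rmult_le_compat_l (/ x ^ m)) in T; [| lra].
  replace (/ x ^ m * / (y / x) ^ m) with (/ y ^ m) in T.
  2:{ rewrite <- Rinv_mult, <- Rpow_mult_distr. do 2 f_equal. field. lra. }
  replace ((y - x) * (- INR m * / x ^ S m)) with (/ x ^ m * (1 - INR m * (y / x - 1)) - / x ^ m).
  lra. rewrite <- tech_pow_Rmult. field. split. apply pow_nonzero. lra. lra.
Qed.

(** Comparison with a telescoping series; the factor 2 comes from [n + 1 <= 2 n]. *)
Lemma ex_series_inv_square : ex_series (fun n => / INR (S n) ^ 2).
Proof.
  assert (T : is_series (fun n => / INR (S n) - / INR (S (S n))) 1).
  { apply (is_lim_seq_ext (fun n => 1 - / INR (S (S n))) _ (Finite 1)).
    - intros n. induction n as [| n IH].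
      + rewrite sum_O. simpl. field.
      + rewrite sum_Sn, <- IH.
        change (1 - / INR (S (S (S n))) = 1 - / INR (S (S n)) + (/ INR (S (S n)) - / INR (S (S (S n))))).
        ring.
    - replace (Finite 1) with (Finite (1 - 0)) by (f_equal; ring).
      apply is_lim_seq_minus'. apply is_lim_seq_const.
      apply is_lim_seq_ext with (fun n => / INR (S (S n)) ^ 1).
      intros n. now rewrite pow_1.
      apply (is_lim_seq_incr_1 (fun n => / INR (S n) ^ 1)), is_lim_seq_inv_S_pow. }
  apply (ex_series_le (V := R_CompleteNormedModule)) with (fun n => 2 * (/ INR (S n) - / INR (S (S n)))).
  - intros n. generalize (INR_S_pos n). intros H.
    change (Rabs (/ INR (S n) ^ 2) <= 2 * (/ INR (S n) - / INR (S (S n)))).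
    rewrite Rabs_pos_eq by (apply Rlt_le, Rinv_0_lt_compat, INR_S_pow_pos).
    rewrite (S_INR (S n)).
    assert (1 <= INR (S n)) by (rewrite S_INR; generalize (pos_INR n); lra).
    replace (/ INR (S n) - / (INR (S n) + 1)) with (/ (INR (S n) * (INR (S n) + 1)))
      by (field; lra).
    replace (2 * / (INR (S n) * (INR (S n) + 1))) with (/ (INR (S n) * (INR (S n) + 1) / 2))
      by (field; lra).
    apply Rinv_le_contravar; nra.
  - eexists. apply (is_series_scal_R 2 _ _ T).
Qed.

Definition hurwitz (m : nat) (s : R) : R := Series (fun j => / (INR j + s) ^ m).

Lemma is_series_hurwitz (m : nat) (s : R) : 1 <= s ->
  is_series (fun j => / (INR j + s) ^ S (S m)) (hurwitz (S (S m)) s).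
Proof.
  intros Hs. apply Series_correct. apply (ex_series_le (V := R_CompleteNormedModule)) with (2 := ex_series_inv_square).
  intros n. change (Rabs (/ (INR n + s) ^ S (S m)) <= / INR (S n) ^ 2).
  generalize (pos_INR n). intros Hn.
  rewrite Rabs_pos_eq by (apply Rlt_le, Rinv_0_lt_compat, pow_lt; lra).
  apply Rinv_le_contravar. apply INR_S_pow_pos. rewrite S_INR.
  apply Rle_trans with ((INR n + s) ^ 2). apply pow_incr. lra.
  apply Rle_pow. lra. lia.
Qed.

(** Each summand is convex: its tangent at [x] gives the lower bound, its tangent at [y] the upper
    one. *)
Lemma hurwitz_sandwich (m : nat) :
  convex_sandwich (hurwitz (S (S m))) (fun x => - INR (S (S m)) * hurwitz (S (S (S m))) x).
Proof.
  intros x y Hx Hy.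
  assert (D := is_series_minus_R _ _ _ _ (is_series_hurwitz m y ltac:(lra)) (is_series_hurwitz m x ltac:(lra))).
  assert (T : forall z, 1 < z -> is_series (fun j => (y - x) * (- INR (S (S m)) * / (INR j + z) ^ S (S (S m))))
     ((y - x) * (- INR (S (S m)) * hurwitz (S (S (S m))) z))).
  { intros z Hz. apply is_series_scal_R, is_series_scal_R, is_series_hurwitz. lra. }
  split; [apply (is_series_le _ _ _ _) with (2 := T x Hx) (3 := D)
         | apply (is_series_le _ _ _ _) with (2 := D) (3 := T y ltac:(lra))];
    intros n; generalize (pos_INR n); intros Hn.
  - generalize (inv_pow_tangent (S (S m)) (INR n + x) (INR n + y)).
    replace (INR n + y - (INR n + x)) with (y - x) by ring. intros I. apply I; lra.
  - generalize (inv_pow_tangent (S (S m)) (INR n + y) (INR n + x)).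
    replace (INR n + x - (INR n + y)) with (- (y - x)) by ring. intros I.
    apply Ropp_le_cancel. eapply Rle_trans; [| eapply Rle_trans; [apply I; lra |]].
    right; ring. right; ring.
Qed.

Lemma is_derive_hurwitz (m : nat) (x : R) : 1 < x ->
  is_derive (hurwitz (S (S m))) x (- INR (S (S m)) * hurwitz (S (S (S m))) x).
Proof.
  intros Hx.
  apply (convex_sandwich_derive _ (fun x => - INR (S (S m)) * hurwitz (S (S (S m))) x)); try easy.
  apply hurwitz_sandwich. apply (continuous_scal_r (- INR (S (S m))) (hurwitz (S (S (S m))))).
  apply convex_sandwich_continuous with (2 := Hx) (1 := hurwitz_sandwich (S m)).
Qed.

Definition digamma_series (s : R) : R :=
  Series (fun j => / INR (S j) - / (INR j + s)) - euler_gamma.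

Lemma is_series_digamma (s : R) : 1 <= s ->
  is_series (fun j => / INR (S j) - / (INR j + s)) (digamma_series s + euler_gamma).
Proof.
  intros Hs. unfold digamma_series.
  replace (Series _ - euler_gamma + euler_gamma) with (Series (fun j => / INR (S j) - / (INR j + s))) by ring.
  apply Series_correct.
  apply (ex_series_le (V := R_CompleteNormedModule)) with (fun n => (s - 1) * / INR (S n) ^ 2).
  - intros n. change (Rabs (/ INR (S n) - / (INR n + s)) <= (s - 1) * / INR (S n) ^ 2).
    generalize (INR_S_pos n). rewrite !S_INR. intros Hn.
    replace (/ (INR n + 1) - / (INR n + s)) with ((s - 1) * / ((INR n + 1) * (INR n + s)))
      by (field; lra).
    assert (0 < (INR n + 1) * (INR n + s)) by (apply Rmult_lt_0_compat; lra).
    rewrite Rabs_pos_eq by (apply Rmult_le_pos; [lra | now apply Rlt_le, Rinv_0_lt_compat]).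
    apply Rmult_le_compat_l. lra. apply Rinv_le_contravar. apply pow_lt; lra. nra.
  - destruct ex_series_inv_square as [l Hl]. eexists. apply (is_series_scal_R (s - 1) _ _ Hl).
Qed.

Lemma ln_diff_bounds (x y : R) : 0 < x -> x <= y ->
  (y - x) * / y <= ln y - ln x <= (y - x) * / x.
Proof.
  intros Hx Hy.
  assert (L : forall w, 0 < w -> ln w <= w - 1).
  { intros w Hw. generalize (exp_ineq1_le (ln w)). rewrite exp_ln by easy. lra. }
  split.
  - generalize (L (x / y)). rewrite ln_div by lra. intros I.
    replace ((y - x) * / y) with (1 - x / y) by (field; lra).
    generalize (I (Rdiv_lt_0_compat x y Hx ltac:(lra))). lra.
  - generalize (L (y / x)). rewrite ln_div by lra. intros I.
    replace ((y - x) * / x) with (y / x - 1) by (field; lra).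
    apply I. apply Rdiv_lt_0_compat; lra.
Qed.

(** The sequence decreases and stays nonnegative, so the [real] of [Lim_seq] in [euler_gamma] is a
    true limit and not a default value. *)
Lemma is_lim_seq_euler_gamma :
  is_lim_seq (fun n => sum_n (fun k => / INR (S k)) n - ln (INR (S n))) euler_gamma.
Proof.
  assert (E : ex_finite_lim_seq (fun n => sum_n (fun k => / INR (S k)) n - ln (INR (S n)))).
  { apply ex_finite_lim_seq_decr with 0.
    - intros n. rewrite sum_Sn. change plus with Rplus.
      destruct (ln_diff_bounds (INR (S n)) (INR (S (S n)))) as [A _].
      apply INR_S_pos. apply le_INR; lia.
      replace (INR (S (S n)) - INR (S n)) with 1 in A by (rewrite (S_INR (S n)); ring).
      rewrite Rmult_1_l in A.
      match goal with |- ?s + _ - _ <= _ => set (S0 := s) end.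
      change (S0 + / INR (S (S n)) - ln (INR (S (S n))) <= S0 - ln (INR (S n))). lra.
    - intros n. enough (ln (INR (S (S n))) <= sum_n (fun k => / INR (S k)) n).
      { assert (ln (INR (S n)) <= ln (INR (S (S n)))).
        apply ln_le. apply INR_S_pos. apply le_INR. lia. lra. }
      induction n as [| n IH].
      + rewrite sum_O. destruct (ln_diff_bounds 1 2) as [_ A]; try lra.
        rewrite ln_1 in A. change (ln (1 + 1) <= / 1). replace (1 + 1) with 2 by ring. lra.
      + rewrite sum_Sn. change plus with Rplus.
        destruct (ln_diff_bounds (INR (S (S n))) (INR (S (S (S n))))) as [_ A].
        apply INR_S_pos. apply le_INR; lia.
        replace (INR (S (S (S n))) - INR (S (S n))) with 1 in A by (rewrite (S_INR (S (S n))); ring).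
        rewrite Rmult_1_l in A.
        apply Rle_trans with (ln (INR (S (S n))) + / INR (S (S n))). lra.
        apply Rplus_le_compat_r, IH. }
  unfold euler_gamma.
  rewrite (Lim_seq_ext _ (fun n => sum_n (fun k => / INR (S k)) n - ln (INR (S n)))).
  now apply Lim_seq_correct'. intros n. now rewrite sum_n_Reals.
Qed.

(** With Euler's constant absorbed, the series becomes a limit with a logarithm, the form that
    iterating the functional equation of [Gamma] produces. *)
Lemma is_lim_seq_digamma (s : R) : 1 <= s ->
  is_lim_seq (fun n => ln (INR (S n)) - sum_n (fun j => / (INR j + s)) n) (digamma_series s).
Proof.
  intros Hs.
  apply is_lim_seq_ext with (fun n => sum_n (fun j => / INR (S j) - / (INR j + s)) n
    - (sum_n (fun k => / INR (S k)) n - ln (INR (S n)))).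
  - intros n.
    enough (E : sum_n (fun j => / INR (S j) - / (INR j + s)) n
      = sum_n (fun k => / INR (S k)) n - sum_n (fun j => / (INR j + s)) n) by (rewrite E; ring).
    induction n as [| n IH]. now rewrite !sum_O.
    rewrite !sum_Sn, IH. change plus with Rplus.
    assert (K : forall a b c d : R, a - b + (c - d) = a + c - (b + d)) by (intros; ring).
    apply K.
  - replace (Finite (digamma_series s)) with (Finite (digamma_series s + euler_gamma - euler_gamma))
      by (f_equal; ring).
    apply is_lim_seq_minus'. now apply is_series_digamma. apply is_lim_seq_euler_gamma.
Qed.

(** The digamma function is concave, hence the opposite sign on both entries. *)
Lemma digamma_series_sandwich :
  convex_sandwich (fun s => - digamma_series s) (fun s => -1 * hurwitz 2 s).
Proof.
  intros x y Hx Hy.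
  assert (D := is_series_minus_R _ _ _ _ (is_series_digamma x ltac:(lra)) (is_series_digamma y ltac:(lra))).
  replace (digamma_series x + euler_gamma - (digamma_series y + euler_gamma))
    with (- digamma_series y - - digamma_series x) in D by ring.
  assert (T : forall z, 1 < z -> is_series (fun j => (y - x) * (-1 * / (INR j + z) ^ 2))
     ((y - x) * (-1 * hurwitz 2 z))).
  { intros z Hz. apply is_series_scal_R, is_series_scal_R, is_series_hurwitz. lra. }
  split; [apply (is_series_le _ _ _ _) with (2 := T x Hx) (3 := D)
         | apply (is_series_le _ _ _ _) with (2 := D) (3 := T y ltac:(lra))];
    intros n; generalize (pos_INR n); intros Hn.
  - generalize (inv_pow_tangent 1 (INR n + x) (INR n + y)).
    replace (INR n + y - (INR n + x)) with (y - x) by ring. rewrite !pow_1. simpl INR.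
    intros I. eapply Rle_trans; [apply I; lra |]. right; ring.
  - generalize (inv_pow_tangent 1 (INR n + y) (INR n + x)).
    replace (INR n + x - (INR n + y)) with (- (y - x)) by ring. rewrite !pow_1. simpl INR.
    intros I. assert (I' := I ltac:(lra) ltac:(lra)). lra.
Qed.

Lemma is_derive_digamma_series (x : R) : 1 < x -> is_derive digamma_series x (hurwitz 2 x).
Proof.
  intros Hx. apply is_derive_ext with (fun s => - - digamma_series s).
  { intros t. apply Ropp_involutive. }
  replace (hurwitz 2 x) with (opp (-1 * hurwitz 2 x)) by (unfold opp; simpl; ring).
  apply (is_derive_opp (fun s => - digamma_series s)).
  apply (convex_sandwich_derive _ (fun s => -1 * hurwitz 2 s)); try easy.
  apply digamma_series_sandwich. apply (continuous_scal_r (-1) (hurwitz 2)).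
  apply convex_sandwich_continuous with (2 := Hx) (1 := hurwitz_sandwich 0).
Qed.

Lemma ln_Gamma_shift (x : R) (n : nat) : 1 < x ->
  ln (Gamma (x + INR (S n))) = ln (Gamma x) + sum_n (fun j => ln (INR j + x)) n.
Proof.
  intros Hx. induction n as [| n IH].
  - rewrite sum_O. simpl. rewrite Gamma_succ, ln_mult, Rplus_0_l by (try apply Gamma_pos; lra).
    apply Rplus_comm.
  - rewrite sum_Sn. change plus with Rplus. rewrite (S_INR (S n)), <- Rplus_assoc.
    generalize (INR_S_pos n). intros Hn.
    rewrite Gamma_succ, ln_mult by (try apply Gamma_pos; lra). rewrite IH.
    rewrite (Rplus_comm (INR (S n)) x).
    enough (K : forall a b c : R, a + (b + c) = b + (c + a)) by apply K.
    intros; ring.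
Qed.

(** Logarithms of the Jensen bounds, the lower one at [x + n] and the upper one at [x + n + 1];
    [x > 1] allows [x + n] to be replaced by [n + 1] below. *)
Lemma ln_Gamma_shift_bounds (x h : R) (n : nat) : 1 < x -> 0 < h <= 1 ->
  h * ln (INR (S n)) <= ln (Gamma (x + h + INR (S n))) - ln (Gamma (x + INR (S n)))
  <= h * ln (x + INR (S n)).
Proof.
  intros Hx Hh. generalize (INR_S_pos n) (pos_INR n). intros Hn Hn'.
  assert (P : 0 < Gamma (x + INR (S n))) by (apply Gamma_pos; lra).
  assert (Q : 0 < Gamma (x + h + INR (S n))) by (apply Gamma_pos; lra).
  split.
  - assert (L := Gamma_lower (x + INR n) h ltac:(lra) ltac:(lra)).
    replace (x + INR n + 1) with (x + INR (S n)) in L by (rewrite S_INR; ring).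
    replace (x + INR (S n) + h) with (x + h + INR (S n)) in L by ring.
    apply ln_le in L. 2: apply Rmult_lt_0_compat; [apply exp_pos | easy].
    rewrite ln_mult in L by (try apply exp_pos; easy).
    unfold Rpower in L. rewrite ln_exp in L.
    assert (ln (INR (S n)) <= ln (x + INR n)).
    { apply ln_le. easy. rewrite S_INR. lra. }
    assert (h * ln (INR (S n)) <= h * ln (x + INR n)) by (apply Rmult_le_compat_l; lra).
    lra.
  - assert (L := Gamma_upper (x + INR (S n)) h ltac:(lra) ltac:(lra)).
    replace (x + INR (S n) + h) with (x + h + INR (S n)) in L by ring.
    apply ln_le in L; [| easy].
    rewrite ln_mult in L by (try apply exp_pos; easy).
    unfold Rpower in L. rewrite ln_exp in L. lra.
Qed.

(* Shifting by [n] reduces the increment of [ln Gamma] to one near [x + n], which is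
   [(y - x) * ln n] up to [o(1)], minus the increments of the [ln (x + j)]. *)
Lemma ln_Gamma_sandwich : convex_sandwich (fun s => ln (Gamma s)) digamma_series.
Proof.
  intros x y Hx Hy.
  assert (E : forall n, ln (Gamma y) - ln (Gamma x) =
    ln (Gamma (y + INR (S n))) - ln (Gamma (x + INR (S n)))
    - (sum_n (fun j => ln (INR j + y)) n - sum_n (fun j => ln (INR j + x)) n)).
  { intros n. rewrite !ln_Gamma_shift by lra. ring. }
  assert (B : forall n, (y - x) * sum_n (fun j => / (INR j + y)) n <=
     sum_n (fun j => ln (INR j + y)) n - sum_n (fun j => ln (INR j + x)) n
     <= (y - x) * sum_n (fun j => / (INR j + x)) n).
  { intros n. induction n as [| n IH].
    - rewrite !sum_O. simpl INR. rewrite !Rplus_0_l. apply ln_diff_bounds; lra.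
    - rewrite !sum_Sn. change plus with Rplus.
      generalize (INR_S_pos n). intros Hn.
      destruct (ln_diff_bounds (INR (S n) + x) (INR (S n) + y)); lra. }
  split.
  - apply (is_lim_seq_le (fun n => (y - x) * (ln (INR (S n)) - sum_n (fun j => / (INR j + x)) n))
      (fun _ => ln (Gamma y) - ln (Gamma x)) ((y - x) * digamma_series x) (ln (Gamma y) - ln (Gamma x))).
    + intros n. rewrite (E n). destruct (B n) as [_ B2].
      destruct (ln_Gamma_shift_bounds x (y - x) n) as [A _]; try lra.
      replace (x + (y - x)) with y in A by ring.
      rewrite Rmult_minus_distr_l. lra.
    + apply (is_lim_seq_scal_l _ (y - x) (digamma_series x)). apply is_lim_seq_digamma. lra.
    + apply is_lim_seq_const.
  (* The upper bound involves [ln (x + n + 1)] in place of [ln (n + 1)]; the excess is at most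
     [x / (n + 1)], which disappears in the limit. *)
  - apply (is_lim_seq_le (fun _ => ln (Gamma y) - ln (Gamma x))
      (fun n => (y - x) * (x * / INR (S n) + (ln (INR (S n)) - sum_n (fun j => / (INR j + y)) n)))
      (ln (Gamma y) - ln (Gamma x)) ((y - x) * digamma_series y)).
    + intros n. rewrite (E n). destruct (B n) as [B1 _].
      destruct (ln_Gamma_shift_bounds x (y - x) n) as [_ A]; try lra.
      replace (x + (y - x)) with y in A by ring.
      generalize (INR_S_pos n). intros Hn.
      destruct (ln_diff_bounds (INR (S n)) (x + INR (S n))) as [_ C]; try lra.
      replace (x + INR (S n) - INR (S n)) with x in C by ring.
      apply (Rmult_le_compat_l (y - x)) in C; [| lra].
      rewrite Rmult_plus_distr_l, Rmult_minus_distr_l.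
      rewrite Rmult_minus_distr_l in C. lra.
    + apply is_lim_seq_const.
    + replace (digamma_series y) with (x * 0 + digamma_series y) by ring.
      apply (is_lim_seq_scal_l _ (y - x) (x * 0 + digamma_series y)).
      apply is_lim_seq_plus'. 2: apply is_lim_seq_digamma; lra.
      apply (is_lim_seq_scal_l _ x 0).
      apply is_lim_seq_ext with (fun n => / INR (S n) ^ 1).
      intros n. now rewrite pow_1. apply is_lim_seq_inv_S_pow.
Qed.

(** Writing [Gamma] as [exp (ln Gamma)] near [x] proves that it is differentiable, so that
    [Derive Gamma] in [digamma] is a genuine derivative. *)
Lemma digamma_eq_series (x : R) : 1 < x -> digamma x = digamma_series x.
Proof.
  intros Hx.
  assert (D : is_derive (fun s => ln (Gamma s)) x (digamma_series x)).
  { apply convex_sandwich_derive; try easy. apply ln_Gamma_sandwich.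
    apply (ex_derive_continuous digamma_series). eexists. now apply is_derive_digamma_series. }
  assert (D' : is_derive Gamma x (digamma_series x * Gamma x)).
  { apply is_derive_ext_loc with (fun s => exp (ln (Gamma s))).
    - generalize (locally_gt x 1 Hx). apply filter_imp. intros y Hy.
      now apply exp_ln, Gamma_pos.
    - rewrite <- (exp_ln (Gamma x)) by now apply Gamma_pos.
      apply (is_derive_comp exp (fun s => ln (Gamma s))); [| easy].
      apply is_derive_exp. }
  unfold digamma. rewrite (is_derive_unique _ _ _ D'). field.
  apply Rgt_not_eq, Gamma_pos. easy.
Qed.

Lemma polygamma_eq_hurwitz (k : nat) (x : R) : 1 < x ->
  polygamma (S k) x = (-1) ^ k * INR (fact (S k)) * hurwitz (S (S k)) x.
Proof.
  unfold polygamma. revert x. induction k as [| k IH]; intros x Hx.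
  - simpl Derive_n. rewrite (Derive_ext_loc _ digamma_series).
    + rewrite (is_derive_unique _ _ _ (is_derive_digamma_series x Hx)). simpl. ring.
    + generalize (locally_gt x 1 Hx). apply filter_imp. apply digamma_eq_series.
  - change (Derive_n digamma (S (S k)) x) with (Derive (Derive_n digamma (S k)) x).
    rewrite (Derive_ext_loc _ (fun x => (-1) ^ k * INR (fact (S k)) * hurwitz (S (S k)) x)).
    + rewrite Derive_scal, (is_derive_unique _ _ _ (is_derive_hurwitz k x Hx)).
      rewrite (fact_simpl (S k)), mult_INR, <- (tech_pow_Rmult (-1) k). ring.
    + generalize (locally_gt x 1 Hx). apply filter_imp. apply IH.
Qed.

Lemma is_series_zeta (m : nat) :
  is_series (fun j => / INR (S j) ^ S (S m)) (zeta (S (S m))).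
Proof.
  unfold zeta. apply Series_correct.
  exists (hurwitz (S (S m)) 1). generalize (is_series_hurwitz m 1 (Rle_refl 1)).
  apply is_series_ext. intros n. now rewrite S_INR.
Qed.

Lemma harmonic_hurwitz (m : nat) (lam : R) : 0 < lam ->
  harmonic (S (S m)) lam = zeta (S (S m)) - hurwitz (S (S m)) (lam + 1).
Proof.
  intros Hl. unfold harmonic. replace (Nat.eqb (S (S m)) 1) with false by easy.
  replace (S (S m) - 1)%nat with (S m) by lia.
  rewrite polygamma_eq_hurwitz by lra.
  assert (P : (-1) ^ S m * (-1) ^ m = -1).
  { rewrite <- pow_add. replace (S m + m)%nat with (S (2 * m)) by lia. apply pow_1_odd. }
  replace ((-1) ^ S m / INR (fact (S m)) * ((-1) ^ m * INR (fact (S m)) * hurwitz (S (S m)) (lam + 1)))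
    with ((-1) ^ S m * (-1) ^ m * hurwitz (S (S m)) (lam + 1)) by (field; apply INR_fact_neq_0).
  rewrite P. ring.
Qed.

(** One series for both branches of [harmonic]: in order 1 Euler's constant cancels, in higher
    orders the sign and the factorial of the polygamma function do. *)
Lemma is_series_harmonic (m : nat) (lam : R) : 0 < lam ->
  is_series (fun j => / INR (S j) ^ S m - / (INR (S j) + lam) ^ S m) (harmonic (S m) lam).
Proof.
  intros Hl. destruct m as [| m].
  - unfold harmonic. simpl Nat.eqb. cbv iota. rewrite digamma_eq_series, Rplus_comm by lra.
    generalize (is_series_digamma (lam + 1) ltac:(lra)). apply is_series_ext.
    intros n. rewrite !pow_1. do 2 f_equal. rewrite S_INR. ring.
  - rewrite harmonic_hurwitz by easy.
    apply is_series_minus_R. apply is_series_zeta.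
    generalize (is_series_hurwitz m (lam + 1) ltac:(lra)). apply is_series_ext.
    intros n. do 2 f_equal. rewrite S_INR. ring.
Qed.

(** * Euler sums and the two half-lines *)

Lemma ex_series_alternating_div (w : nat -> R) (t : nat) :
  (forall n, 0 <= w (S n) <= w n) ->
  ex_series (fun n => (-1) ^ n * (w n / INR (S n) ^ S t)).
Proof.
  intros Hw.
  assert (W0 : forall n, w n <= w O).
  { intros n. induction n as [| n IH]. lra. generalize (Hw n). lra. }
  assert (Wp : forall n, 0 <= w n) by (intros n; generalize (Hw n); lra).
  destruct (alternating_series (fun n => w n / INR (S n) ^ S t)) as [l [Hl _]].
  - intros n. apply Rmult_le_compat. apply Wp.
    apply Rlt_le, Rinv_0_lt_compat, INR_S_pow_pos. apply Hw. apply inv_S_pow_decr.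
  - apply is_lim_seq_le_le with (fun _ => 0) (fun n => w O * / INR (S n) ^ S t).
    + intros n. generalize (Rinv_0_lt_compat _ (INR_S_pow_pos n (S t))). intros H. split.
      apply Rmult_le_pos. apply Wp. lra. apply Rmult_le_compat_r. lra. apply W0.
    + apply is_lim_seq_const.
    + replace (Finite 0) with (Rbar_mult (w O) 0) by (simpl; f_equal; ring).
      apply is_lim_seq_scal_l, is_lim_seq_inv_S_pow.
  - now exists l.
Qed.

Lemma is_series_nonneg (a : nat -> R) (l : R) :
  (forall n, 0 <= a n) -> is_series a l -> 0 <= l.
Proof.
  intros H Ha. apply (is_lim_seq_le (fun _ => 0) (sum_n a) 0 l); [| | apply Ha].
  - intros n. induction n as [| n IH]. now rewrite sum_O.
    rewrite sum_Sn. change plus with Rplus. apply Rplus_le_le_0_compat; easy.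
  - apply is_lim_seq_const.
Qed.

Lemma hurwitz_nonneg (m : nat) (s : R) : 1 <= s -> 0 <= hurwitz (S (S m)) s.
Proof.
  intros Hs. apply is_series_nonneg with (2 := is_series_hurwitz m s Hs).
  intros n. apply Rlt_le, Rinv_0_lt_compat, pow_lt. generalize (pos_INR n). lra.
Qed.

Lemma hurwitz_decr (m : nat) (x y : R) : 1 <= x <= y ->
  hurwitz (S (S m)) y <= hurwitz (S (S m)) x.
Proof.
  intros H. apply is_series_le with
    (2 := is_series_hurwitz m y ltac:(lra)) (3 := is_series_hurwitz m x ltac:(lra)).
  intros n. generalize (pos_INR n). intros Hn. apply Rinv_le_contravar.
  apply pow_lt. lra. apply pow_incr. lra.
Qed.

(** [harmonic 1] grows with [lam], so Leibniz' criterion does not apply to it directly; this series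
    shows that its quotient by [lam] decreases. *)
Lemma is_series_harmonic_1_div (lam : R) : 0 < lam ->
  is_series (fun j => / (INR (S j) * (INR (S j) + lam))) (harmonic 1 lam / lam).
Proof.
  intros Hl. replace (harmonic 1 lam / lam) with (/ lam * harmonic 1 lam) by apply Rmult_comm.
  generalize (is_series_scal_R (/ lam) _ _ (is_series_harmonic 0 lam Hl)).
  apply is_series_ext. intros n. generalize (INR_S_pos n). intros Hn.
  rewrite !pow_1. change (/ lam * (/ INR (S n) - / (INR (S n) + lam)) = / (INR (S n) * (INR (S n) + lam))).
  field. lra.
Qed.

(** In order 1, passing to [harmonic 1 lam / lam] costs one power of the index, which [1 <= m + t]
    provides. In higher orders the harmonic number is a constant minus a decreasing Hurwitz value,
    and each part alternates. *)
Lemma ex_series_euler_sum (m t : nat) (r : R) : 0 < r -> (1 <= m + t)%nat ->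
  ex_series (fun k => (-1) ^ k * (harmonic (S m) (r * INR (S k)) / INR (S k) ^ S t)).
Proof.
  intros Hr Hmt.
  assert (Hp : forall k, 0 < r * INR (S k)).
  { intros k. apply Rmult_lt_0_compat. easy. apply INR_S_pos. }
  assert (Hi : forall k, r * INR (S k) <= r * INR (S (S k))).
  { intros k. apply Rmult_le_compat_l. lra. apply le_INR. lia. }
  destruct m as [| m].
  - destruct t as [| t]. lia.
    destruct (ex_series_alternating_div
      (fun k => r * (harmonic 1 (r * INR (S k)) / (r * INR (S k)))) t) as [l Hl].
    + intros k. split.
      * apply Rmult_le_pos. lra.
        apply is_series_nonneg with (2 := is_series_harmonic_1_div _ (Hp (S k))).
        intros n. generalize (INR_S_pos n) (Hp (S k)). intros.
        apply Rlt_le, Rinv_0_lt_compat, Rmult_lt_0_compat; lra.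
      * apply Rmult_le_compat_l. lra.
        apply is_series_le with (2 := is_series_harmonic_1_div _ (Hp (S k)))
          (3 := is_series_harmonic_1_div _ (Hp k)).
        intros n. generalize (INR_S_pos n) (Hp k) (Hi k). intros.
        apply Rinv_le_contravar. apply Rmult_lt_0_compat; lra.
        apply Rmult_le_compat_l; lra.
    + exists l. revert Hl. apply is_series_ext. intros k.
      generalize (INR_S_pos k). intros Hk. rewrite <- (tech_pow_Rmult _ (S t)).
      apply (f_equal (Rmult _)). field. split. apply INR_S_pow_neq_0. lra.
  - destruct (ex_series_alternating_div (fun k => hurwitz (S (S m)) (r * INR (S k) + 1)) t) as [l Hl].
    + intros k. generalize (Hp (S k)) (Hp k) (Hi k). intros. split.
      apply hurwitz_nonneg. lra. apply hurwitz_decr. lra.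
    + eexists. generalize (is_series_minus_R _ _ _ _
        (is_series_scal_R (zeta (S (S m))) _ _ (is_series_eta t)) Hl).
      apply is_series_ext. intros k. rewrite harmonic_hurwitz by apply Hp.
      change (@eq R (zeta (S (S m)) * ((-1) ^ k * / INR (S k) ^ S t)
        - (-1) ^ k * (hurwitz (S (S m)) (r * INR (S k) + 1) / INR (S k) ^ S t))
       ((-1) ^ k * ((zeta (S (S m)) - hurwitz (S (S m)) (r * INR (S k) + 1)) / INR (S k) ^ S t))).
      unfold Rdiv. ring.
Qed.

(* Subtracting twice the even-indexed terms turns a series into the alternating one. *)
Lemma harmonic_duplication (m : nat) (c : R) : 0 < c ->
  harmonic (S m) c - / 2 ^ m * harmonic (S m) (c / 2)
  = eta (S m) - alt_hurwitz (S m) c.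
Proof.
  intros Hc.
  set (phi := fun j => / INR (S j) ^ S m - / (INR (S j) + c) ^ S m).
  set (psi := fun j => / INR (S j) ^ S m - / (INR (S j) + c / 2) ^ S m).
  assert (H1 : is_series phi (harmonic (S m) c)) by now apply is_series_harmonic.
  assert (H2 : is_series psi (harmonic (S m) (c / 2))) by (apply is_series_harmonic; lra).
  assert (H3 : is_series (fun j => (-1) ^ j * phi j) (eta (S m) - alt_hurwitz (S m) c)).
  { generalize (is_series_minus_R _ _ _ _ (is_series_eta m) (is_series_alt_hurwitz m c ltac:(lra))).
    apply is_series_ext. intros n. unfold phi. rewrite (Rplus_comm c), Rmult_minus_distr_l.
    reflexivity. }
  (* Index [S (2 * N)] stands for the integer [2 N + 2], so these are the even-indexed terms of
     [phi], doubled. *)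
  assert (P : forall N, / 2 ^ m * psi N = 2 * phi (S (2 * N))).
  { intros N. unfold psi, phi. replace (INR (S (S (2 * N)))) with (2 * INR (S N)).
    2:{ rewrite !S_INR, mult_INR. simpl. ring. }
    generalize (INR_S_pos N). intros HN.
    replace (2 * INR (S N) + c) with (2 * (INR (S N) + c / 2)) by field.
    rewrite !Rpow_mult_distr. rewrite <- (tech_pow_Rmult 2 m).
    field. repeat split; apply pow_nonzero; lra. }
  (* Cutting after an even number of terms matches each [psi N] with a complete pair of terms of
     [phi]; a subsequence suffices because all the limits are known to exist. *)
  assert (E : forall N, sum_n phi (S (2 * N)) - / 2 ^ m * sum_n psi N
              = sum_n (fun j => (-1) ^ j * phi j) (S (2 * N))).
  { intros N. induction N as [| N IH].
    - rewrite !sum_Sn. change (S (2 * 0)) with 1%nat. change (2 * 0)%nat with O.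
      rewrite !sum_O. change plus with Rplus.
      generalize (P O). change (S (2 * 0)) with 1%nat. simpl pow. lra.
    - replace (2 * S N)%nat with (S (S (2 * N))) by lia.
      rewrite (sum_Sn phi (S (S _))), (sum_Sn phi (S _)), (sum_Sn psi).
      rewrite (sum_Sn _ (S (S (2 * N)))), (sum_Sn _ (S (2 * N))). rewrite <- IH.
      generalize (P (S N)). replace (2 * S N)%nat with (S (S (2 * N))) by lia.
      replace ((-1) ^ S (S (2 * N))) with 1
        by (replace (S (S (2 * N))) with (2 * S N)%nat by lia; symmetry; apply pow_1_even).
      replace ((-1) ^ S (S (S (2 * N)))) with (-1)
        by (replace (S (S (S (2 * N)))) with (S (2 * S N)) by lia; symmetry; apply pow_1_odd).
      change plus with Rplus. intros PN. rewrite Rmult_plus_distr_l, PN.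
      assert (K : forall a b d e f : R, a + b + d - (e + 2 * d) = a - e + 1 * b + -1 * d)
        by (intros; ring). apply (K _ _ _ _ 0). }
  assert (L : is_lim_seq (fun N => sum_n phi (S (2 * N)) - / 2 ^ m * sum_n psi N)
     (harmonic (S m) c - / 2 ^ m * harmonic (S m) (c / 2))).
  { apply is_lim_seq_minus'.
    - apply (is_lim_seq_subseq (sum_n phi)); [| exact H1].
      apply eventually_subseq. intros n. lia.
    - apply (is_lim_seq_scal_l _ _ (harmonic (S m) (c / 2))). exact H2. }
  apply is_lim_seq_unique in L.
  assert (L' : is_lim_seq (fun N => sum_n (fun j => (-1) ^ j * phi j) (S (2 * N)))
     (eta (S m) - alt_hurwitz (S m) c)).
  { apply (is_lim_seq_subseq (sum_n (fun j => (-1) ^ j * phi j))); [| exact H3].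
    apply eventually_subseq. intros n. lia. }
  apply (is_lim_seq_ext _ _ _ (fun N => eq_sym (E N))) in L'. apply is_lim_seq_unique in L'.
  rewrite L in L'. now injection L'.
Qed.

Lemma is_series_euler_sum (m t : nat) (r : R) : 0 < r -> (1 <= m + t)%nat ->
  is_series (fun k => (-1) ^ k * (harmonic (S m) (r * INR (S k)) / INR (S k) ^ S t))
    (euler_sum_pm (S m) (S t) r).
Proof.
  intros Hr Hmt. unfold euler_sum_pm.
  rewrite (Series_ext _ (fun k => (-1) ^ k * (harmonic (S m) (r * INR (S k)) / INR (S k) ^ S t))).
  - now apply Series_correct, ex_series_euler_sum.
  - intros k. replace (S k + 1)%nat with (k + 2)%nat by lia. rewrite pow_add. ring.
Qed.

(** Duplication at [c = q n], weighted by the alternating sign over [n^t] and summed over [n]; here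
    [(q / 2) n = c / 2]. *)
Lemma euler_sum_duplication (m t : nat) (q l : R) : 0 < q -> (1 <= m + t)%nat ->
  is_series (fun n => (-1) ^ n * (alt_hurwitz (S m) (q * INR (S n)) / INR (S n) ^ S t)) l ->
  euler_sum_pm (S m) (S t) q - / 2 ^ m * euler_sum_pm (S m) (S t) (q / 2)
  - eta (S m) * eta (S t) = - l.
Proof.
  intros Hq Hmt Hl.
  assert (H1 := is_series_minus_R _ _ _ _ (is_series_euler_sum m t q Hq Hmt)
    (is_series_scal_R (/ 2 ^ m) _ _ (is_series_euler_sum m t (q / 2) ltac:(lra) Hmt))).
  assert (H2 := is_series_minus_R _ _ _ _ (is_series_scal_R (eta (S m)) _ _ (is_series_eta t)) Hl).
  enough (E : euler_sum_pm (S m) (S t) q - / 2 ^ m * euler_sum_pm (S m) (S t) (q / 2)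
     = eta (S m) * eta (S t) - l) by (rewrite E; ring).
  rewrite <- (is_series_unique _ _ H1). apply is_series_unique.
  revert H2. apply is_series_ext. intros n.
  assert (P : 0 < q * INR (S n)) by (apply Rmult_lt_0_compat; [easy | apply INR_S_pos]).
  replace (q / 2 * INR (S n)) with (q * INR (S n) / 2) by field.
  assert (D := harmonic_duplication m _ P).
  transitivity ((-1) ^ n * ((eta (S m) - alt_hurwitz (S m) (q * INR (S n))) / INR (S n) ^ S t)).
  - change (@eq R (eta (S m) * ((-1) ^ n * / INR (S n) ^ S t) -
      (-1) ^ n * (alt_hurwitz (S m) (q * INR (S n)) / INR (S n) ^ S t))
      ((-1) ^ n * ((eta (S m) - alt_hurwitz (S m) (q * INR (S n))) / INR (S n) ^ S t))).
    unfold Rdiv. ring.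
  - rewrite <- D.
    match goal with |- @eq _ ?a ?b => change (@eq R a b) end. unfold Rdiv. ring.
Qed.

Lemma is_improper_comp_scal (f : R -> R) (l c : R) : 0 < c ->
  is_improper f l -> is_improper (fun x => f (c * x)) (/ c * l).
Proof.
  intros Hc [E L].
  assert (I : forall M, 0 <= M -> is_RInt (fun x => f (c * x)) 0 M (/ c * RInt f 0 (c * M))).
  { intros M HM.
    assert (J : is_RInt f (c * 0 + 0) (c * M + 0) (RInt f 0 (c * M))).
    { rewrite Rmult_0_r, !Rplus_0_r. apply (@RInt_correct R_CompleteNormedModule), E.
      apply Rmult_le_pos; lra. }
    apply (is_RInt_comp_lin f c 0 0 M) in J.
    apply (is_RInt_scal _ _ _ (/ c)) in J. revert J. apply is_RInt_ext.
    intros x _. change (/ c * (c * f (c * x + 0)) = f (c * x)). rewrite Rplus_0_r. field. lra. }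
  split.
  - intros M HM. eexists. now apply I.
  - apply is_lim_ext_pos with (fun M => / c * RInt f 0 (c * M)).
    + intros M HM. symmetry. apply is_RInt_unique, I. lra.
    + apply (is_lim_scal_l (fun M => RInt f 0 (c * M)) (/ c) p_infty l).
      intros P HP. destruct (L P HP) as [M0 HM0]. exists (M0 / c). intros x Hx.
      apply HM0. apply (Rmult_lt_compat_l c) in Hx; [| easy].
      replace (c * (M0 / c)) with M0 in Hx by (field; lra). easy.
Qed.

Lemma is_RInt_gen_pos_half (f : R -> R) (l : R) :
  is_improper f l -> is_RInt_gen f (at_point 0) (Rbar_locally p_infty) l.
Proof.
  intros [E L] P HP. destruct (L P HP) as [M0 HM0].
  exists (fun a => a = 0) (fun M => 0 < M /\ M0 < M).
  - easy.
  - exists (Rmax 0 M0). intros x Hx.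
    split; eapply Rle_lt_trans; [apply Rmax_l | apply Hx | apply Rmax_r | apply Hx].
  - intros a M -> [HM1 HM2]. exists (RInt f 0 M). split.
    apply (@RInt_correct R_CompleteNormedModule), E. lra. now apply HM0.
Qed.

Lemma is_RInt_gen_neg_half (f : R -> R) (l : R) :
  is_improper (fun x => f (- x)) l -> is_RInt_gen f (Rbar_locally m_infty) (at_point 0) l.
Proof.
  intros [E L] P HP. destruct (L P HP) as [M0 HM0].
  exists (fun M => M < 0 /\ M < - M0) (fun a => a = 0).
  - exists (Rmin 0 (- M0)). intros x Hx.
    split; eapply Rlt_le_trans; [apply Hx | apply Rmin_l | apply Hx | apply Rmin_r].
  - easy.
  - intros M a [HM1 HM2] ->. exists (RInt (fun x => f (- x)) 0 (- M)). split.
    + assert (J : is_RInt (fun x => f (- x)) (- M) (- 0) (- RInt (fun x => f (- x)) 0 (- M))).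
      { rewrite Ropp_0. apply (is_RInt_swap (fun x => f (- x))).
        apply (@RInt_correct R_CompleteNormedModule), E. lra. }
      apply (is_RInt_comp_opp (fun x => f (- x)) M 0) in J.
      apply (is_RInt_opp (V := R_NormedModule)) in J.
      rewrite <- (Ropp_involutive (RInt _ _ _)). revert J.
      apply is_RInt_ext. intros x _. change (- - f (- - x) = f x). now rewrite !Ropp_involutive.
    + apply HM0. lra.
Qed.

(** Each monomial contributes a moment of the Fermi factor, obtained from [is_improper_fermi] at
    [c = 0]; this is why a trivial factor [exp (- (0 * u))] is inserted. *)
Lemma is_improper_inversion_poly (p t : nat) (q : R) :
  is_improper (fun u => u ^ p * inversion_poly t (q * u) * / (1 + exp u))
    (sum_n (fun j => eta (2 * j) * q ^ (t - 2 * j) / INR (fact (t - 2 * j))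
       * (INR (fact (p + t - 2 * j)) * eta (p + t + 1 - 2 * j))) (t / 2)).
Proof.
  assert (Ht : (2 * (t / 2) <= t)%nat) by apply Nat.Div0.mul_div_le.
  rewrite (sum_n_ext_loc _ (fun j => eta (2 * j) * q ^ (t - 2 * j) / INR (fact (t - 2 * j))
       * (INR (fact (p + (t - 2 * j))) * alt_hurwitz (S (p + (t - 2 * j))) 0))).
  2:{ intros j Hj. rewrite alt_hurwitz_0.
      replace (S (p + (t - 2 * j))) with (p + t + 1 - 2 * j)%nat by lia.
      replace (p + (t - 2 * j))%nat with (p + t - 2 * j)%nat by lia. easy. }
  apply is_improper_ext with (fun u => sum_n (fun j =>
    eta (2 * j) * q ^ (t - 2 * j) / INR (fact (t - 2 * j))
       * (u ^ (p + (t - 2 * j)) * exp (- (0 * u)) * / (1 + exp u))) (t / 2)).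
  - intros u Hu. unfold inversion_poly.
    transitivity (mult (u ^ p * / (1 + exp u)) (sum_n (fun j => eta (2 * j) * ((q * u) ^ (t - 2 * j) / INR (fact (t - 2 * j)))) (t / 2))).
    + rewrite <- (sum_n_mult_l (K := R_Ring)). apply sum_n_ext. intros j.
      rewrite Rmult_0_l, Ropp_0, exp_0, pow_add, Rpow_mult_distr.
      match goal with |- @eq _ ?a (mult ?b ?c) => change (@eq R a (b * c)) end.
      unfold Rdiv. ring.
    + match goal with |- mult ?a ?b = ?c => change (a * b = c) end.
      match goal with |- context [sum_n ?f ?n] => generalize (sum_n f n) end.
      intros s.
      assert (K : forall a b s : R, a * b * s = a * s * b) by (intros; ring). apply K.
  - apply (is_improper_sum_n (fun j u => eta (2 * j) * q ^ (t - 2 * j) / INR (fact (t - 2 * j))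
       * (u ^ (p + (t - 2 * j)) * exp (- (0 * u)) * / (1 + exp u)))).
    intros j. apply is_improper_scal, is_improper_fermi. lra.
Qed.

Lemma integrand_pos_half (p t : nat) (q J : R) :
  is_improper (fun x => x ^ p * polylog_exp t (- (q * x)) * / (1 + exp x)) J ->
  is_improper (integrand q 1 p t)
    (- (-1) ^ t * J + -2 * sum_n (fun j => eta (2 * j) * q ^ (t - 2 * j) / INR (fact (t - 2 * j))
       * (INR (fact (p + t - 2 * j)) * eta (p + t + 1 - 2 * j))) (t / 2)).
Proof.
  intros HJ.
  apply is_improper_ext with (2 := is_improper_plus _ _ _ _
    (is_improper_scal (- (-1) ^ t) _ _ HJ) (is_improper_scal (-2) _ _ (is_improper_inversion_poly p t q))).
  intros u _. unfold integrand. rewrite Rmult_1_l.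
  change (polylog t (- exp (q * u))) with (polylog_exp t (q * u)).
  replace (polylog_exp t (q * u)) with
    (-2 * inversion_poly t (q * u) - (-1) ^ t * polylog_exp t (- (q * u)))
    by (rewrite <- polylog_exp_inversion; ring).
  unfold Rdiv. ring.
Qed.

Lemma integrand_neg_half (p t : nat) (q J : R) : 0 < q ->
  is_improper (fun x => x ^ p * polylog_exp t (- (q * x)) * / (1 + exp x)) J ->
  is_improper (fun x => integrand q 1 p t (- x))
    ((-1) ^ p * (- (INR (fact p) / q ^ S p * eta (S (p + t))) + -1 * J)).
Proof.
  intros Hq HJ.
  apply is_improper_ext with (2 := is_improper_scal ((-1) ^ p) _ _ (is_improper_plus _ _ _ _
    (is_improper_polylog_exp_pow p t q Hq) (is_improper_scal (-1) _ _ HJ))).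
  intros u _. unfold integrand. rewrite Rmult_1_l.
  replace (q * - u) with (- (q * u)) by ring.
  change (polylog t (- exp (- (q * u)))) with (polylog_exp t (- (q * u))).
  replace ((- u) ^ p) with ((-1) ^ p * u ^ p) by (rewrite <- Rpow_mult_distr; f_equal; ring).
  rewrite exp_Ropp. generalize (exp_pos u). intros. field. lra.
Qed.

(** Substitution [u = b x]. A negative [b] exchanges the two half-lines, so the Jacobian is
    [/ Rabs b], whereas [x ^ p] contributes [/ b ^ p] with its sign. *)
Lemma is_RInt_gen_integrand (p t : nat) (a b P N : R) : 0 < a * b ->
  is_improper (integrand (a / b) 1 p t) P ->
  is_improper (fun x => integrand (a / b) 1 p t (- x)) N ->
  is_RInt_gen (integrand a b p t) (Rbar_locally m_infty) (Rbar_locally p_infty)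
    (/ b ^ p * / Rabs b * (P + N)).
Proof.
  intros Hab HP HN.
  assert (Hb : b <> 0) by (intros ->; lra).
  assert (Hb' : 0 < Rabs b) by now apply Rabs_pos_lt.
  assert (E : forall x, integrand a b p t x = / b ^ p * integrand (a / b) 1 p t (b * x)).
  { intros x. unfold integrand. rewrite Rmult_1_l, Rpow_mult_distr.
    replace (a / b * (b * x)) with (a * x) by (field; easy).
    field. split. generalize (exp_pos (b * x)). lra. now apply pow_nonzero. }
  apply (is_improper_comp_scal _ _ _ Hb') in HP, HN.
  apply (is_improper_scal (/ b ^ p)) in HP, HN.
  destruct (Rlt_or_le 0 b) as [L | L].
  - rewrite (Rabs_pos_eq b) in * by lra.
    replace (/ b ^ p * / b * (P + N)) with (plus (/ b ^ p * (/ b * N)) (/ b ^ p * (/ b * P)))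
      by (unfold plus; simpl; ring).
    apply (is_RInt_gen_Chasles (V := R_NormedModule)) with 0.
    + apply is_RInt_gen_neg_half. apply is_improper_ext with (2 := HN).
      intros x _. rewrite E. do 2 f_equal. ring.
    + apply is_RInt_gen_pos_half. apply is_improper_ext with (2 := HP).
      intros x _. now rewrite E.
  - rewrite (Rabs_left1 b) in * by lra.
    replace (/ b ^ p * / - b * (P + N)) with (plus (/ b ^ p * (/ - b * P)) (/ b ^ p * (/ - b * N)))
      by (unfold plus; simpl; ring).
    apply (is_RInt_gen_Chasles (V := R_NormedModule)) with 0.
    + apply is_RInt_gen_neg_half. apply is_improper_ext with (2 := HP).
      intros x _. rewrite E. do 2 f_equal. ring.
    + apply is_RInt_gen_pos_half. apply is_improper_ext with (2 := HN).
      intros x _. rewrite E. do 2 f_equal. ring.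
Qed.

Lemma sum_n_scal_R (c : R) (f : nat -> R) (n : nat) :
  sum_n (fun k => c * f k) n = c * sum_n f n.
Proof. exact (sum_n_mult_l (K := R_Ring) c f n). Qed.

(** The binomial coefficient times [p!] is [(p+t-2j)! / (t-2j)!]: the factorial of a Fermi moment
    over that of an inversion coefficient. The bound [2 j <= t] keeps the natural subtractions
    exact. *)
Lemma eta_part_value (p t : nat) (q : R) : 0 < q ->
  INR (fact p) * eta_part p t q =
    (-1) ^ p * - (INR (fact p) / q ^ S p * eta (S (p + t)))
    + -2 * sum_n (fun j => eta (2 * j) * q ^ (t - 2 * j) / INR (fact (t - 2 * j))
       * (INR (fact (p + t - 2 * j)) * eta (p + t + 1 - 2 * j))) (t / 2).
Proof.
  intros Hq. unfold eta_part.
  assert (Ht : (2 * (t / 2) <= t)%nat) by apply Nat.Div0.mul_div_le.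
  rewrite (sum_n_ext_loc _ (fun j => INR (fact p) * (q ^ (t - 2 * j) * Binomial.C (p + t - 2 * j) p
          * eta (p + t + 1 - 2 * j) * eta (2 * j)))).
  - rewrite sum_n_scal_R, <- sum_n_Reals.
    match goal with |- context [sum_n ?f ?n] => generalize (sum_n f n : R) end.
    intros s. rewrite Nat.add_1_r. replace (p + t + 1)%nat with (S (p + t)) by lia.
    rewrite <- (tech_pow_Rmult (-1)). field. apply pow_nonzero. lra.
  - intros j Hj.
    unfold Binomial.C. replace (p + t - 2 * j - p)%nat with (t - 2 * j)%nat by lia.
    match goal with |- @eq _ ?a ?b => change (@eq R a b) end.
    field. split; apply INR_fact_neq_0.
Qed.

Theorem theorem1p1 (t p : nat) (a b : R) (ht : (1 <= t)%nat) (hab : 0 < a * b) :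
  let q := a / b in
  ex_RInt_gen (integrand a b p t) (Rbar_locally m_infty) (Rbar_locally p_infty) /\
  (Nat.Odd (p + t) ->
     sign b / INR (fact p) * b ^ (p + 1) * I_minus a b p t = eta_part p t q) /\
  (Nat.Even (p + t) ->
     sign b / INR (fact p) * b ^ (p + 1) * I_minus a b p t =
       eta_part p t q
       + 2 * (-1) ^ (p + 1) *
           (euler_sum_pm (p + 1) t q
            - / 2 ^ p * euler_sum_pm (p + 1) t (q / 2)
            - eta (p + 1) * eta t)).
Proof.
  intros q.
  assert (Hb : b <> 0) by (intros ->; lra).
  assert (Hq : 0 < q).
  { unfold q. replace (a / b) with (a * b * / b ^ 2) by (field; easy).
    apply Rmult_lt_0_compat. easy. apply Rinv_0_lt_compat. now apply pow2_gt_0. }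
  destruct (is_improper_polylog_exp_fermi p t q Hq) as [J [HJ Hs]].
  assert (I := is_RInt_gen_integrand p t a b _ _ hab (integrand_pos_half p t q J HJ)
    (integrand_neg_half p t q J Hq HJ)).
  (* Here [sign b * b^(p+1) = b^p * Rabs b] cancels the scaling factors, and [J] remains with a
     coefficient decided by parity alone. *)
  assert (V : sign b / INR (fact p) * b ^ (p + 1) * I_minus a b p t
    = eta_part p t q - ((-1) ^ t + (-1) ^ p) * (J / INR (fact p))).
  { unfold I_minus. rewrite (is_RInt_gen_unique _ _ I).
    assert (Eta := eta_part_value p t q Hq).
    match type of Eta with context [sum_n ?f ?n] => revert Eta; generalize (sum_n f n) end.
    intros s Eta.
    replace (sign b / INR (fact p) * b ^ (p + 1)) with (b ^ p * Rabs b * / INR (fact p)).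
    2:{ rewrite pow_add, pow_1.
        destruct (Rlt_or_le 0 b).
        rewrite (sign_eq_1 b), Rabs_pos_eq by lra. unfold Rdiv; ring.
        rewrite (sign_eq_m1 b), Rabs_left1 by lra. unfold Rdiv; ring. }
    apply Rmult_eq_reg_l with (INR (fact p)). 2: apply INR_fact_neq_0.
    rewrite Rmult_minus_distr_l, Eta. field.
    repeat split; try apply pow_nonzero; auto using INR_fact_neq_0, Rabs_no_R0, Rgt_not_eq. }
  split; [| split].
  - eexists. apply I.
  - intros [k Hk]. rewrite V.
    replace ((-1) ^ t) with (- (-1) ^ p). ring.
    replace t with (2 * k + 1 - p)%nat by lia.
    destruct (Nat.Even_or_Odd p) as [[i ->] | [i ->]].
    + replace (2 * k + 1 - 2 * i)%nat with (S (2 * (k - i))) by lia.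
      rewrite pow_1_even, pow_1_odd. ring.
    + replace (2 * k + 1 - (2 * i + 1))%nat with (2 * (k - i))%nat by lia.
      rewrite Nat.add_1_r, pow_1_even, pow_1_odd. ring.
  - intros [k Hk]. rewrite V.
    destruct t as [| t]. lia.
    rewrite Nat.add_1_r.
    (* The condition [1 <= p + t], with [t] now the predecessor of the order, comes from parity: an
       even positive number is at least 2. *)
    rewrite (euler_sum_duplication p t q _ Hq ltac:(lia) Hs).
    replace ((-1) ^ S t) with ((-1) ^ p).
    rewrite <- (tech_pow_Rmult (-1) p). unfold Rdiv. ring.
    replace (S t) with (2 * k - p)%nat by lia.
    destruct (Nat.Even_or_Odd p) as [[i ->] | [i ->]].
    + replace (2 * k - 2 * i)%nat with (2 * (k - i))%nat by lia.
      now rewrite !pow_1_even.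
    + replace (2 * k - (2 * i + 1))%nat with (S (2 * (k - i - 1))) by lia.
      now rewrite Nat.add_1_r, !pow_1_odd.
Qed.
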